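(* Consider a Wasserstein distributionally robust MDP with type $p\in\mathbb{N}$, $p\ge 1$, or $p=\infty$, and let $v^{*}\in\mathbb{R}^{S}$ be the value vector of a pair $(x^{*},y^{*})$ of optimal solutions, i.e. $v^*_s=\min_{x_s\in\Delta(A)}\max_{y_s\in\mathbb{B}_{p,s}}\sum_{a}x_{sa}(c_{sa}+\lambda y_{sa}^{\top}v^{*})$ for every state $s$. Run Algorithm FOM (defined in the context) for $k$ epochs, let $T=\sum_{\ell=1}^{k}\ell^{2}$ be the total number of primal-dual iterations, let $(\bar x^{T}_s,(\bar y^{T}_{i,s})_{i})_s$ be its output, and let $\bar y^{T}_s=\frac1N\sum_{i=1}^N\bar y^{T}_{i,s}$. Then the duality gap $$\max_{s}\Big\{\max_{y'\in\mathbb{B}_{p,s}}F^{\bar x^{T},y'}(v^{*})_{s}-\min_{x'\in\Delta(A)}F^{x',\bar y^{T}}(v^{*})_{s}\Big\}$$ is upper bounded by $$O\left(\frac{\sqrt S}{\sqrt N}\,R_XR_Y\left(\frac{\Theta_X}{\tau}+\frac{\Theta_Y}{\sigma}\right)\frac{1}{T^{2/3}}\right).$$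
   Context: **Model.** There are finitely many states ($|\mathbb S|=S$) and actions ($|\mathbb A|=A$), costs $c\in\mathbb{R}^{S\times A}$, an initial distribution $p_0\in\Delta(S)$ and a discount factor $\lambda\in(0,1)$; $\Delta(n)$ is the probability simplex in $\mathbb{R}^n$. Let $\mathcal U=(\Delta(S))^{A}$; an element $y_s=(y_{sa})_{a}\in\mathcal U$ gives the transition probabilities out of state $s$. Policies are $x\in\Pi=(\Delta(A))^{S}$. A metric $d$ on $\mathcal U$ is fixed, one of $d_1,d_2,d_\infty$, induced by the norms $\ell_1,\ell_2,\ell_\infty$ on $\mathbb{R}^{A\times S}$. For each state $s$ nominal kernels $\hat y_{1,s},\dots,\hat y_{N,s}\in\mathcal U$ are given, together with a radius $\theta$; the nominal distribution is $\nu_s=\frac1N\sum_{i=1}^N\delta_{\hat y_{i,s}}$. The ambiguity set is the set of product measures $\mu=\bigotimes_s\mu_s$ with each $\mu_s$ a Borel probability measure on $\mathcal U$ within type-$p$ Wasserstein distance $\theta$ of $\nu_s$ (w.r.t. $d$). The set of $N$-tuples of kernels at $s$ is $$\tilde{\mathbb B}_{p,s}=\Big\{(y_i)_{i=1}^N\in\mathcal U^N:\tfrac1N\sum_{i=1}^N d(y_i,\hat y_{i,s})^p\le\theta^p\Big\}\ (p<\infty),\qquad \tilde{\mathbb B}_{\infty,s}=\{(y_i)_{i=1}^N\in\mathcal U^N: d(y_i,\hat y_{i,s})\le\theta\ \forall i\},$$ and $\mathbb B_{p,s}=\{\frac1N\sum_{i=1}^N y_i:(y_i)_i\in\tilde{\mathbb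 B}_{p,s}\}$ is the set of expected kernels. For $x_s\in\Delta(A)$, $y_s\in\mathcal U$, $v\in\mathbb{R}^S$ put $F^{x,y}(v)_s=\sum_a x_{sa}(c_{sa}+\lambda y_{sa}^\top v)$. **Proximal setup (Euclidean).** For each state, $X=\Delta(A)$, $Y=\tilde{\mathbb B}_{p,s}$, with norms $\|\cdot\|_X=\|\cdot\|_Y=\ell_2$, $D_X(x,x')=\frac12\|x-x'\|_2^2$ and $D_Y((y_i)_i,(y'_i)_i)=\sum_{i=1}^N\frac12\|y_i-y'_i\|_2^2$. Set $\mathrm{prox}_x(g,x')=\arg\min_{x\in X}\langle g,x\rangle+D_X(x,x')$ and $\mathrm{prox}_y(g,y')=\arg\max_{y\in Y}\langle g,y\rangle-D_Y(y,y')$. Let $\Theta_X,\Theta_Y$ be the maxima of $D_X,D_Y$ on $X\times X$, $Y\times Y$, and $R_X=\max_{x\in X}\|x\|_X$, $R_Y=\max_{y\in Y}\|y\|_Y$ (maximized over states where they depend on $s$). **Algorithm FOM.** Input: number of epochs $k$. Choose $v^1\in\mathbb{R}^S$ and, for each $s$, a starting point $(x^0_s,(y^0_{i,s})_i)\in\Delta(A)\times\tilde{\mathbb B}_{p,s}$ arbitrarily (at random). Let $\tau_\ell=\sum_{k'=1}^{\ell-1}k'^2$. For epochs $\ell=1,\dots,k$ and each state $s$: 1. Step sizes $\tau=(\sqrt A\,\lambda\|v^\ell\|_2)^{-1}$, $\sigma=N\sqrt A\,(\lambda\|v^\ell\|_2)^{-1}$ (it is implicit that $v^\ell\neq0$).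 2. For $t=\tau_\ell,\dots,\tau_\ell+\ell^2-1$: $x_s^{t+1}=\mathrm{prox}_x(\tau g^t,x_s^t)$ with $g^t_a=c_{sa}+\lambda\frac1N\sum_i (y^{t}_{i,sa})^\top v^\ell$; then $(y^{t+1}_{i,s})_i=\mathrm{prox}_y(\sigma h^t,(y^t_{i,s})_i)$ with $h^t_{ias'}=\frac{\lambda}{N}(2x^{t+1}_{sa}-x^t_{sa})v^\ell_{s'}$. 3. With $S_\ell=\sum_{t=\tau_\ell+1}^{\tau_\ell+\ell^2}t$, set $(\bar x^\ell_s,(\bar y^\ell_{i,s})_i)=\sum_{t=\tau_\ell+1}^{\tau_\ell+\ell^2}\frac{t}{S_\ell}(x^t_s,(y^t_{i,s})_i)$, $\bar y^\ell_s=\frac1N\sum_i\bar y^\ell_{i,s}$, and $v^{\ell+1}_s=F^{\bar x^\ell,\bar y^\ell}(v^\ell)_s$. Output: $(\bar x^T_s,(\bar y^T_{i,s})_i)=\sum_{t=1}^T\frac{t}{S_T}(x^t_s,(y^t_{i,s})_i)$ with $S_T=\sum_{t=1}^Tt$. **Conventions.** The $O(\cdot)$ hides constants depending only on $\lambda$, the bound $\max_{s,a}|c_{sa}|$ and the initialization $\|v^1\|_\infty$. Since $\tau,\sigma$ depend on $\ell$, the factor $\Theta_X/\tau+\Theta_Y/\sigma$ is understood as its maximum over the epochs of the run.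
   Formalization: With a single action (A=1) the bound is stated only for k at least some k0 depending on the MDP instance, since then Theta_X=0 and no uniform constant works for small radius; for A at least 2 it holds for every k at least 1. *)

(* Defs.v *)
(* MathComp / MathComp-Analysis *)
From HB Require Import structures.
From mathcomp Require Import all_boot all_order all_algebra.
From mathcomp Require Import all_classical all_reals all_analysis.

Set Implicit Arguments.
Unset Strict Implicit.
Unset Printing Implicit Defensive.
Import Order.TTheory GRing.Theory Num.Theory.
Local Open Scope classical_set_scope.
Local Open Scope ring_scope.

(* Conventions.
   - Kernels out of one state are matrices y : 'M[R]_(A, S), y a s' being the
     probability of moving to s' under action a; costs are c : 'M[R]_(S, A).
   - Maxima and minima over the sets below are written with sup and inf.  All
     these sets are nonempty and compact and all objectives are continuous, so
     the extrema are attained.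
   - \big[Num.max/0] is used only for maxima of nonnegative quantities over
     nonempty finite families. *)

Inductive metric_kind := d_one | d_two | d_infty.

Inductive wtype := WFinite of nat | WInfty.

Definition wtype_ok (p : wtype) : Prop :=
  match p with WFinite q => (1 <= q)%N | WInfty => True end.

Section Norms.
Variables (R : realType) (m n : nat).
Implicit Types B C : 'M[R]_(m, n).

Definition dotm B C : R := \sum_i \sum_j B i j * C i j.
Definition norm1 B : R := \sum_i \sum_j `|B i j|.
Definition norm2 B : R := Num.sqrt (dotm B B).
Definition norminf B : R := \big[Num.max/0]_i \big[Num.max/0]_j `|B i j|.

Definition dist (d : metric_kind) B C : R :=
  match d with
  | d_one => norm1 (B - C)
  | d_two => norm2 (B - C)
  | d_infty => norminf (B - C)
  end.

End Norms.

Section Sets.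
Variable R : realType.

Definition simplex (n : nat) : set 'rV[R]_n :=
  [set x | (forall j, 0 <= x 0 j) /\ \sum_j x 0 j = 1].

Definition kernels (A S : nat) : set 'M[R]_(A, S) :=
  [set y | forall a, simplex (row a y)].

Definition is_argmin (T : Type) (X : set T) (f : T -> R) (x : T) : Prop :=
  X x /\ forall z, X z -> f x <= f z.

Definition is_argmax (T : Type) (X : set T) (f : T -> R) (x : T) : Prop :=
  X x /\ forall z, X z -> f z <= f x.

End Sets.

Record wdrmdp (R : realType) (S A N : nat) := WDRMDP {
  cost : 'M[R]_(S, A);
  init : 'rV[R]_S;
  disc : R;
  metric : metric_kind;
  wass : wtype;
  nominal : 'I_S -> 'I_N -> 'M[R]_(A, S);
  radius : R;
  states_gt0 : (0 < S)%N;
  actions_gt0 : (0 < A)%N;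
  samples_gt0 : (0 < N)%N;
  init_simplex : simplex init;
  disc_gt0 : 0 < disc;
  disc_lt1 : disc < 1;
  wass_ok : wtype_ok wass;
  nominal_kernel : forall s i, kernels (nominal s i);
  radius_ge0 : 0 <= radius
}.

Section Model.
Variables (R : realType) (S A N : nat) (M : wdrmdp R S A N).

Definition ktuple := 'I_N -> 'M[R]_(A, S).

Definition kmean (y : ktuple) : 'M[R]_(A, S) := N%:R^-1 *: \sum_i y i.

Definition ball_tuple (s : 'I_S) : set ktuple :=
  [set y | (forall i, kernels (y i)) /\
    match wass M with
    | WFinite p =>
        N%:R^-1 * \sum_i dist (metric M) (y i) (nominal M s i) ^+ p
          <= radius M ^+ p
    | WInfty => forall i, dist (metric M) (y i) (nominal M s i) <= radius M
    end].

Definition ball_mean (s : 'I_S) : set 'M[R]_(A, S) := kmean @` ball_tuple s.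

Definition Fop (s : 'I_S) (x : 'rV[R]_A) (y : 'M[R]_(A, S)) (v : 'cV[R]_S) : R :=
  \sum_a x 0 a * (cost M s a + disc M * (y *m v) a 0).

Definition is_value (v : 'cV[R]_S) : Prop :=
  forall s, v s 0 =
    inf [set sup [set Fop s x y v | y in ball_mean s] | x in @simplex R A].

Definition D_X (x x' : 'rV[R]_A) : R := 2^-1 * norm2 (x - x') ^+ 2.
Definition D_Y (y y' : ktuple) : R :=
  \sum_i 2^-1 * norm2 (y i - y' i) ^+ 2.

Definition dotY (h y : ktuple) : R := \sum_i dotm (h i) (y i).
Definition normY (y : ktuple) : R := Num.sqrt (dotY y y).

Definition is_prox_x (g x' x : 'rV[R]_A) : Prop :=
  is_argmin (@simplex R A) (fun z => dotm g z + D_X z x') x.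
Definition is_prox_y (s : 'I_S) (h y' y : ktuple) : Prop :=
  is_argmax (ball_tuple s) (fun z => dotY h z - D_Y z y') y.

Definition Theta_X : R :=
  sup [set D_X x x' | x in @simplex R A & x' in @simplex R A].
Definition Theta_Y : R := \big[Num.max/0]_s
  sup [set D_Y y y' | y in ball_tuple s & y' in ball_tuple s].
Definition R_X : R := sup [set norm2 x | x in @simplex R A].
Definition R_Y : R := \big[Num.max/0]_s sup [set normY y | y in ball_tuple s].

Definition step_x (v : 'cV[R]_S) : R :=
  (Num.sqrt A%:R * disc M * norm2 v)^-1.
Definition step_y (v : 'cV[R]_S) : R :=
  N%:R * Num.sqrt A%:R * (disc M * norm2 v)^-1.

Definition grad_x (s : 'I_S) (y : ktuple) (v : 'cV[R]_S) : 'rV[R]_A :=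
  \row_a (cost M s a + disc M * (N%:R^-1 * \sum_i (y i *m v) a 0)).

(* The two arguments are the new and the previous primal iterates. *)
Definition grad_y (xnew xold : 'rV[R]_A) (v : 'cV[R]_S) : ktuple :=
  fun=> \matrix_(a, s') (disc M / N%:R * (2 * xnew 0 a - xold 0 a) * v s' 0).

Definition epoch_start (l : nat) : nat := (\sum_(1 <= j < l) j ^ 2)%N.

(* Average of z over times lo, .., hi - 1, the weight of time t being
   proportional to t. *)
Definition wavg (V : lmodType R) (lo hi : nat) (z : nat -> V) : V :=
  \sum_(lo <= t < hi) (t%:R / \sum_(lo <= u < hi) u%:R) *: z t.

Definition wavgY (lo hi : nat) (y : nat -> ktuple) : ktuple :=
  fun i => wavg lo hi (fun t => y t i).

(* A run of k epochs: x t s and y t s are the iterates at (global) time t for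
   state s, v l is the vector used during epoch l = 1, .., k. *)
Record FOM_run (k : nat) (x : nat -> 'I_S -> 'rV[R]_A)
    (y : nat -> 'I_S -> ktuple) (v : nat -> 'cV[R]_S) : Prop := FOMRun {
  run_x0 : forall s, simplex (x 0%N s);
  run_y0 : forall s, ball_tuple s (y 0%N s);
  run_v_neq0 : forall l, (1 <= l <= k)%N -> v l != 0;
  run_x : forall l t s, (1 <= l <= k)%N ->
    (epoch_start l <= t < epoch_start l + l ^ 2)%N ->
    is_prox_x (step_x (v l) *: grad_x s (y t s) (v l)) (x t s) (x t.+1 s);
  run_y : forall l t s, (1 <= l <= k)%N ->
    (epoch_start l <= t < epoch_start l + l ^ 2)%N ->
    is_prox_y s (fun i => step_y (v l) *: grad_y (x t.+1 s) (x t s) (v l) i)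
      (y t s) (y t.+1 s);
  run_v : forall l s, (1 <= l <= k)%N ->
    let lo := (epoch_start l).+1 in
    let hi := (epoch_start l + l ^ 2).+1 in
    v l.+1 s 0 = Fop s (wavg lo hi (x ^~ s)) (kmean (wavgY lo hi (y ^~ s))) (v l)
}.

Definition duality_gap (xb : 'I_S -> 'rV[R]_A) (yb : 'I_S -> 'M[R]_(A, S))
    (v : 'cV[R]_S) : R :=
  sup [set (sup [set Fop s (xb s) y' v | y' in ball_mean s]
            - inf [set Fop s x' (yb s) v | x' in @simplex R A]) | s in [set: 'I_S]].

(* The step sizes change from epoch to epoch: the largest value of
   Theta_X / tau + Theta_Y / sigma over epochs 1, .., k. *)
Definition Theta_step (k : nat) (v : nat -> 'cV[R]_S) : R :=
  \big[Num.max/0]_(1 <= l < k.+1)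
    (Theta_X / step_x (v l) + Theta_Y / step_y (v l)).

End Model.

(* Main.v *)
Require Import Defs.
From mathcomp Require Import all_boot all_order all_algebra.
From mathcomp Require Import all_classical all_reals all_analysis.
From mathcomp Require Import ring lra zify.
Set Implicit Arguments.
Unset Strict Implicit.
Unset Printing Implicit Defensive.
Import Order.TTheory GRing.Theory Num.Theory.
Local Open Scope classical_set_scope.
Local Open Scope ring_scope.

(** Why the rate holds. For a fixed value vector v the state-s game is a
bilinear saddle point problem with coupling K(x, y) = lambda x.(ybar v), and the
iterations of one epoch are primal-dual (Chambolle-Pock) steps for it. The step
sizes are chosen so that tau sigma |K|^2 <= 1, which makes the energy
E = D_X / tau + D_Y / sigma - K nonnegative ([coupling_le]); on the feasible set
it is at most 2 Theta, where Theta bounds Theta_X / tau + Theta_Y / sigma over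
the epochs. The three-point property of the two prox maps gives
L(x+, y') - L(x', y+) <= E_t - E_{t+1} ([primal_dual_step]).
Weighting time t by t and summing by parts ([weighted_telescope]), epoch l
contributes at most 2 Theta times its last time, about l^3 / 3.

Two consequences follow. Inside epoch l the weights sum to order l^5, so the
epoch average has gap at most 4 Theta / l^2 for v^l ([epoch_avg_gap]), and
hence, by the lambda-contraction of the robust Bellman operator,
delta_{l+1} <= lambda delta_l + 4 Theta / l^2 for delta_l = |v^l - v*|_oo
([value_error_rec]). Across epochs, replacing v^l by v* costs 2 lambda delta_l
per iterate, so the total weighted gap is at most
2 Theta k^4 + 2 lambda sum_l l^5 delta_l ([total_weighted_gap]). The recursion
for delta makes the last sum O(delta_1 + Theta k^4)
([sum_pow5_geometric_recursion]). Dividing by the total weight, at least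
T^2 / 2 with T >= k^3 / 3, yields O((delta_1 + Theta k^4) / T^2), and
k^4 / T^2 <= 9 T^(-2/3) ([pow4_div_sqr_le]).

It remains to absorb delta_1, which is bounded by
|v^1|_oo + |c|_oo / (1 - lambda), and the dimensional factor. The factor
sqrt(S/N) R_X R_Y is at least 1, because a probability vector on S points has
squared norm at least 1 / S ([scaled_R_Y_ge1]). With at least two actions
Theta_X >= 1, so Theta >= lambda |v^1|_oo and delta_1 is at most a constant
multiple of Theta. With one action Theta_X = 0 and only
Theta >= Theta_Y lambda |v^1|_oo / N is available; then
delta_1 = O(Theta k^4) once k >= N / Theta_Y. If moreover Theta_Y = 0, every
player has a single strategy and the gap is zero. *)

(** * Proximal steps in an inner product space *)

(** The difference of the two sides is, by induction, at least
    a b (s - t) (s^n - t^n), and the last two factors have the same sign. *)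
Lemma convex_exprn (R : realDomainType) (a b s t : R) (n : nat) :
  0 <= a -> 0 <= b -> a + b = 1 -> 0 <= s -> 0 <= t ->
  (a * s + b * t) ^+ n <= a * s ^+ n + b * t ^+ n.
Proof.
move=> a0 b0 ab s0 t0; elim: n => [|n IH]; first by rewrite !expr0 !mulr1 ab.
have st0 : 0 <= a * s + b * t by rewrite addr_ge0 ?mulr_ge0.
rewrite exprS; apply: le_trans (ler_wpM2l st0 IH) _.
have chebyshev : 0 <= (s - t) * (s ^+ n - t ^+ n).
  have [st|/ltW ts] := leP s t.
    by rewrite mulr_le0 ?subr_le0 // lerXn2r.
  by rewrite mulr_ge0 ?subr_ge0 // lerXn2r.
rewrite !exprS -subr_ge0.
have -> : a * (s * s ^+ n) + b * (t * t ^+ n)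
    - (a * s + b * t) * (a * s ^+ n + b * t ^+ n)
    = a * b * ((s - t) * (s ^+ n - t ^+ n)).
  have -> : b = 1 - a by rewrite -ab addrAC subrr add0r.
  ring.
by apply: mulr_ge0 => //; exact: mulr_ge0.
Qed.

(** Lets a first-order optimality condition be read off difference quotients
    without taking a limit. *)
Lemma affine_ge0_at0 (R : realFieldType) (p q : R) :
  0 <= q -> (forall t, 0 < t <= 1 -> 0 <= p + t * q) -> 0 <= p.
Proof.
move=> q0 H; have [//|p0] := leP 0 p.
have qp : 0 < q - p by lra.
(* At this t in (0, 1/2] the value is at most p / 2. *)
have : 0 <= p + (- p / (2 * (q - p))) * q.
  apply: H; rewrite divr_gt0 ?mulr_gt0 ?oppr_gt0 //= ler_pdivrMr ?mulr_gt0 //.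
  lra.
rewrite -(pmulr_rge0 _ (_ : 0 < 2 * (q - p))) ?mulr_gt0 //.
rewrite mulrDr mulrCA mulrA (mulrC (2 * (q - p))) -mulrA mulrA divfK; last first.
  by rewrite mulf_neq0 // gt_eqF.
nra.
Qed.

Record bilinear_form (R : realType) (U V : lmodType R) (K : U -> V -> R) :
  Prop := BilinearForm {
  bilinl : forall a u u' w, K (a *: u + u') w = a * K u w + K u' w;
  bilinr : forall a u w w', K u (a *: w + w') = a * K u w + K u w'
}.

Record semi_inner (R : realType) (V : lmodType R) (dot : V -> V -> R) :
  Prop := SemiInner {
  inner_bilin : bilinear_form dot;
  innerC : forall u w, dot u w = dot w u;
  inner_ge0 : forall u, 0 <= dot u u
}.

Definition convex_closed (R : realType) (V : lmodType R) (X : set V) : Prop :=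
  forall t u w, 0 <= t <= 1 -> X u -> X w -> X (t *: u + (1 - t) *: w).

Section Bilinear.
Variables (R : realType) (U V : lmodType R) (K : U -> V -> R).
Hypothesis bK : bilinear_form K.

Lemma bilinZl a u w : K (a *: u) w = a * K u w.
Proof.
have := bilinl bK 0 u u w; rewrite scale0r add0r mul0r add0r => _.
have := bilinl bK 1 0 0 w; rewrite scale1r addr0 mul1r => /eqP.
rewrite -subr_eq subrr => /eqP /esym K0.
by have := bilinl bK a u 0 w; rewrite addr0 K0 addr0.
Qed.

Lemma bilinZr a u w : K u (a *: w) = a * K u w.
Proof.
have := bilinr bK 1 u 0 0; rewrite scale1r addr0 mul1r => /eqP.
rewrite -subr_eq subrr => /eqP /esym K0.
by have := bilinr bK a u w 0; rewrite addr0 K0 addr0.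
Qed.

Lemma bilinDl u u' w : K (u + u') w = K u w + K u' w.
Proof. by have := bilinl bK 1 u u' w; rewrite scale1r mul1r. Qed.

Lemma bilinDr u w w' : K u (w + w') = K u w + K u w'.
Proof. by have := bilinr bK 1 u w w'; rewrite scale1r mul1r. Qed.

Lemma bilinNl u w : K (- u) w = - K u w.
Proof. by rewrite -scaleN1r bilinZl mulN1r. Qed.

Lemma bilinNr u w : K u (- w) = - K u w.
Proof. by rewrite -scaleN1r bilinZr mulN1r. Qed.

Definition bilinE := (bilinDl, bilinDr, bilinNl, bilinNr, bilinZl, bilinZr).
End Bilinear.

Section Inner.
Variables (R : realType) (V : lmodType R) (dot : V -> V -> R).
Hypothesis ip : semi_inner dot.
Let b := inner_bilin ip.
Implicit Types (u w : V).

Lemma cauchy_schwarz u w : dot u w <= Num.sqrt (dot u u) * Num.sqrt (dot w w).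
Proof.
rewrite -sqrtrM ?(inner_ge0 ip)//.
have [h|h] := leP (dot u w) 0; first by rewrite (le_trans h) ?sqrtr_ge0.
rewrite -[leLHS]ger0_norm ?(ltW h)// -sqrtr_sqr ler_wsqrtr //.
have uw := innerC ip w u.
have [ww|ww] := eqVneq (dot w w) 0.
  (* The quadratic dot (t w + u) (t w + u) is then affine in t. *)
  have := inner_ge0 ip ((- (dot u u + 1) / (2 * dot u w)) *: w + u).
  rewrite !(bilinE b) uw ww !mulr0 add0r.
  set q := dot u u; set p := dot u w.
  have -> : - (q + 1) / (2 * p) * p + (- (q + 1) / (2 * p) * p + q) = - 1.
    by field; rewrite gt_eqF.
  by rewrite ler0N1.
have wp : 0 < dot w w by rewrite lt_neqAle eq_sym ww (inner_ge0 ip).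
have := inner_ge0 ip (dot w w *: u - dot u w *: w).
rewrite !(bilinE b) uw => H.
by rewrite -(ler_pM2l wp) -subr_ge0; move: H; congr (0 <= _); ring.
Qed.

Lemma sqrt_inner_convex t u w : 0 <= t <= 1 ->
  Num.sqrt (dot (t *: u + (1 - t) *: w) (t *: u + (1 - t) *: w))
  <= t * Num.sqrt (dot u u) + (1 - t) * Num.sqrt (dot w w).
Proof.
move=> /andP[t0 t1]; have t1' : 0 <= 1 - t by rewrite subr_ge0.
set a := Num.sqrt (dot u u); set c := Num.sqrt (dot w w).
have a0 : 0 <= a by exact: sqrtr_ge0.
have c0 : 0 <= c by exact: sqrtr_ge0.
have ac0 : 0 <= t * a + (1 - t) * c by rewrite addr_ge0 ?mulr_ge0.
rewrite -[leRHS]ger0_norm// -sqrtr_sqr ler_wsqrtr //.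
rewrite !(bilinE b) (innerC ip w u).
have cs : t * (1 - t) * dot u w <= t * (1 - t) * (a * c).
  by rewrite ler_wpM2l ?mulr_ge0 ?cauchy_schwarz.
have : a ^+ 2 = dot u u by rewrite sqr_sqrtr ?(inner_ge0 ip).
have : c ^+ 2 = dot w w by rewrite sqr_sqrtr ?(inner_ge0 ip).
by move=> <- <-; lra.
Qed.

(** The prox objective is 1-strongly convex and x minimizes it over X, so that
    moving to z costs an extra |z - x|^2 / 2. *)
Lemma prox_three_point (X : set V) (g c x z : V) :
  convex_closed X -> X x -> X z ->
  (forall z, X z -> dot g x + dot (x - c) (x - c) / 2
                 <= dot g z + dot (z - c) (z - c) / 2) ->
  dot g x + dot (x - c) (x - c) / 2 + dot (z - x) (z - x) / 2
  <= dot g z + dot (z - c) (z - c) / 2.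
Proof.
move=> cX Xx Xz xmin.
have foc : 0 <= dot g (z - x) + dot (z - x) (x - c).
  apply: (@affine_ge0_at0 _ _ (dot (z - x) (z - x) / 2)).
    by rewrite divr_ge0 ?(inner_ge0 ip).
  move=> t /andP[t0 t1]; rewrite -(pmulr_rge0 _ t0).
  have t01 : 0 <= t <= 1 by rewrite (ltW t0).
  have := xmin _ (cX _ _ _ t01 Xz Xx).
  rewrite -subr_ge0; congr (0 <= _).
  rewrite !(bilinE b) (innerC ip x c) (innerC ip z c) (innerC ip z x).
  by field.
rewrite -subr_ge0; move: foc; congr (0 <= _).
rewrite !(bilinE b) (innerC ip x c) (innerC ip z c) (innerC ip z x).
by field.
Qed.

End Inner.

Section PrimalDual.
Variables (R : realType) (U V : lmodType R).
Variables (dU : U -> U -> R) (dV : V -> V -> R) (K : U -> V -> R) (c : U -> R).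
Variables (X : set U) (Y : set V) (tau sigma : R).
Hypotheses (ipU : semi_inner dU) (ipV : semi_inner dV) (bK : bilinear_form K).
Hypotheses (cX : convex_closed X) (cY : convex_closed Y).
Hypotheses (tau_gt0 : 0 < tau) (sigma_gt0 : 0 < sigma).

(** The quadratic form of the metric in which the primal-dual iteration is a
    proximal point method. *)
Definition pd_energy (u : U) (w : V) : R :=
  dU u u / 2 / tau + dV w w / 2 / sigma - K u w.

(** Adding the two three-point inequalities, divided by tau and sigma, leaves the
    coupling terms K(u, w); the extrapolated point 2 x1 - x is exactly what makes
    them recombine into the cross terms of three energies. *)
Lemma primal_dual_step (x x1 x' : U) (y y1 y' : V) (g : U) (h : V) :
  X x1 -> Y y1 -> X x' -> Y y' ->
  (forall z, dU g z = tau * (c z + K z y)) ->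
  (forall z, dV h z = sigma * K (2 *: x1 - x) z) ->
  (forall z, X z -> dU g x1 + dU (x1 - x) (x1 - x) / 2
                 <= dU g z + dU (z - x) (z - x) / 2) ->
  (forall z, Y z -> dV h z - dV (z - y) (z - y) / 2
                 <= dV h y1 - dV (y1 - y) (y1 - y) / 2) ->
  (c x1 + K x1 y') - (c x' + K x' y1)
  <= pd_energy (x' - x) (y' - y) - pd_energy (x' - x1) (y' - y1)
     - pd_energy (x1 - x) (y1 - y).
Proof.
move=> Xx1 Yy1 Xx' Yy' gE hE xopt yopt.
have yopt' z : Y z -> dV (- h) y1 + dV (y1 - y) (y1 - y) / 2
                   <= dV (- h) z + dV (z - y) (z - y) / 2.
  move=> /yopt; rewrite !(bilinNl (inner_bilin ipV)).
  move: (dV h y1) (dV h z) => *; lra.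
have := prox_three_point ipU cX Xx1 Xx' xopt.
have := prox_three_point ipV cY Yy1 Yy' yopt'.
rewrite !(bilinNl (inner_bilin ipV)) !gE !hE.
rewrite /pd_energy.
move: (dU (x1 - x) (x1 - x)) (dU (x' - x) (x' - x)) (dU (x' - x1) (x' - x1)).
move: (dV (y1 - y) (y1 - y)) (dV (y' - y) (y' - y)) (dV (y' - y1) (y' - y1)).
move=> b1 b2 b3 a1 a2 a3.
rewrite !(bilinE bK) => Hy Hx.
have {}Hy := ler_wpM2r (ltW (_ : 0 < sigma^-1)) Hy.
have {}Hx := ler_wpM2r (ltW (_ : 0 < tau^-1)) Hx.
rewrite !invr_gt0 in Hx Hy.
have {Hy} := Hy sigma_gt0; have {Hx} := Hx tau_gt0.
rewrite !(mulrDl _ _ tau^-1) !(mulrDl _ _ sigma^-1) !mulNr.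
rewrite ![tau * _ / tau]mulrAC ![sigma * _ / sigma]mulrAC.
rewrite !divff ?gt_eqF // !mul1r.
lra.
Qed.

End PrimalDual.

(** Abel summation: passing from weight t to t + 1 leaves one copy of V t, which
    is at most B, so only the last weight survives. *)
Lemma weighted_telescope (R : realDomainType) (V : nat -> R) (B : R) (a d : nat) :
  (forall t, (a <= t < a + d)%N -> V t <= B) -> V a <= B ->
  \sum_(a <= t < a + d) t.+1%:R * (V t - V t.+1) + (a + d)%:R * V (a + d)%N
  <= (a + d)%:R * B.
Proof.
move=> VB Va; elim: d VB => [|d IH] VB.
  by rewrite addn0 big_geq // add0r ler_wpM2l.
have /VB Vad : (a <= a + d < a + d.+1)%N by rewrite leq_addr addnS ltnS leqnn.
have {}IH : \sum_(a <= t < a + d) t.+1%:R * (V t - V t.+1)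
  + (a + d)%:R * V (a + d)%N <= (a + d)%:R * B.
  apply: IH => t /andP[h1 h2]; apply: VB; rewrite h1 addnS ltnS; exact: ltnW.
rewrite addnS big_nat_recr ?leq_addr //= -natr1.
move: IH Vad; lra.
Qed.

(** * Matrix norms, the simplex and weighted averages *)

Section MatrixNorms.
Variables (R : realType) (m n : nat).
Implicit Types (B C E : 'M[R]_(m, n)) (t : R).

Lemma dotm_inner : semi_inner (@dotm R m n).
Proof.
split=> [|B C|B].
- split=> [a B C E|a B C E]; rewrite /dotm mulr_sumr -big_split /=;
    apply: eq_bigr => i _; rewrite mulr_sumr -big_split /=;
    by apply: eq_bigr => j _; rewrite !mxE; ring.
- by apply: eq_bigr => i _; apply: eq_bigr => j _; rewrite mulrC.
- by apply: sumr_ge0 => i _; apply: sumr_ge0 => j _; rewrite -expr2 sqr_ge0.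
Qed.

Lemma sqr_norm2 B : norm2 B ^+ 2 = dotm B B.
Proof. by rewrite sqr_sqrtr ?(inner_ge0 dotm_inner). Qed.

Lemma le_norminf B i j : `|B i j| <= norminf B.
Proof.
apply: le_trans (le_bigmax _ _ i).
exact: (le_bigmax _ (fun j => `|B i j|) j).
Qed.

Lemma norminf_le B (b : R) : 0 <= b -> (forall i j, `|B i j| <= b) ->
  norminf B <= b.
Proof. by move=> b0 Bb; apply: bigmax_le => // i _; apply: bigmax_le. Qed.

Lemma norminf_ge0 B : 0 <= norminf B.
Proof. exact: bigmax_ge_id. Qed.

Lemma norminf_gt0 B : B != 0 -> 0 < norminf B.
Proof.
move=> B0; rewrite lt_neqAle norminf_ge0 andbT.
apply: contraNneq B0 => B0; apply/eqP/matrixP => i j; rewrite mxE.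
by apply/eqP; rewrite -normr_le0 B0 le_norminf.
Qed.

Lemma norm2_ge0 B : 0 <= norm2 B.
Proof. exact: sqrtr_ge0. Qed.

Lemma norminf_le_norm2 B : norminf B <= norm2 B.
Proof.
apply: norminf_le (norm2_ge0 B) _ => i j.
rewrite -(@ler_pXn2r _ 2) ?nnegrE ?norm2_ge0 // sqr_norm2 real_normK ?num_real //.
rewrite /dotm (bigD1 i) //= (bigD1 j) //= -expr2 -addrA lerDl addr_ge0 //.
  by apply: sumr_ge0 => k _; rewrite -expr2 sqr_ge0.
by apply: sumr_ge0 => k _; apply: sumr_ge0 => l _; rewrite -expr2 sqr_ge0.
Qed.

Lemma norm2_gt0 B : B != 0 -> 0 < norm2 B.
Proof. by move=> /norminf_gt0 B0; apply: lt_le_trans B0 (norminf_le_norm2 B). Qed.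

Lemma dist_ge0 d B C : 0 <= dist d B C.
Proof.
case: d; rewrite /= ?norm2_ge0 ?norminf_ge0 //.
by apply: sumr_ge0 => i _; apply: sumr_ge0.
Qed.

Lemma distxx d B : dist d B B = 0.
Proof.
case: d; rewrite /= subrr.
- by rewrite /norm1 big1 // => i _; rewrite big1 // => j _; rewrite mxE normr0.
- rewrite /norm2 /dotm big1 ?sqrtr0 // => i _; rewrite big1 // => j _.
  by rewrite mxE mulr0.
- apply/le_anti; rewrite norminf_ge0 andbT; apply: norminf_le => // i j.
  by rewrite mxE normr0.
Qed.

Lemma dist_convex d t B C E : 0 <= t <= 1 ->
  dist d (t *: B + (1 - t) *: C) E <= t * dist d B E + (1 - t) * dist d C E.
Proof.
move=> /andP[t0 t1]; have t1' : 0 <= 1 - t by rewrite subr_ge0.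
have -> : forall d', dist d' (t *: B + (1 - t) *: C) E
    = dist d' (t *: (B - E) + (1 - t) *: (C - E)) 0.
  move=> d'; rewrite /dist subr0 !scalerBr addrACA -opprD -scalerDl.
  by rewrite [t + _]addrC subrK scale1r.
have entry i j : `|(t *: (B - E) + (1 - t) *: (C - E)) i j|
    <= t * `|(B - E) i j| + (1 - t) * `|(C - E) i j|.
  rewrite [X in `|X|]mxE [X in `|X + _|]mxE [X in `|_ + X|]mxE.
  by rewrite (le_trans (ler_normD _ _)) // !normrM (ger0_norm t0) (ger0_norm t1').
case: d; rewrite /= subr0.
- rewrite /norm1 !mulr_sumr -big_split /=; apply: ler_sum => i _.
  by rewrite !mulr_sumr -big_split /=; apply: ler_sum => j _; exact: entry.
- by apply: (sqrt_inner_convex dotm_inner); rewrite t0.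
- apply: norminf_le => [|i j]; first by rewrite addr_ge0 // mulr_ge0 ?norminf_ge0.
  by apply: le_trans (entry i j) _; rewrite lerD // ler_wpM2l // le_norminf.
Qed.

End MatrixNorms.

Section Simplex.
Variables (R : realType) (n : nat).
Implicit Types (x z : 'rV[R]_n).

Lemma simplex_ge0 x j : simplex x -> 0 <= x 0 j.
Proof. by case. Qed.

Lemma simplex_sum x : simplex x -> \sum_j x 0 j = 1.
Proof. by case. Qed.

Lemma simplex_le1 x j : simplex x -> x 0 j <= 1.
Proof.
by case=> x0 <-; rewrite (bigD1 j) //= lerDl; apply: sumr_ge0 => i _.
Qed.

Lemma simplex_convex : convex_closed (@simplex R n).
Proof.
move=> t u w /andP[t0 t1] [u0 u1] [w0 w1]; split=> [j|].
  by rewrite !mxE addr_ge0 // mulr_ge0 // subr_ge0.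
under eq_bigr do rewrite !mxE.
by rewrite big_split /= -!mulr_sumr u1 w1; ring.
Qed.

Lemma simplex_mean_le x (f : 'I_n -> R) (b : R) : simplex x ->
  (forall j, f j <= b) -> \sum_j x 0 j * f j <= b.
Proof.
move=> [x0 x1] fb; rewrite -[leRHS]mul1r -x1 mulr_suml.
by apply: ler_sum => j _; rewrite ler_wpM2l.
Qed.

Lemma simplex_mean_norm_le x (f : 'I_n -> R) (b : R) : simplex x ->
  (forall j, `|f j| <= b) -> `|\sum_j x 0 j * f j| <= b.
Proof.
move=> sx fb; apply: le_trans (ler_norm_sum _ _ _) _.
under eq_bigr do rewrite normrM (ger0_norm (simplex_ge0 _ sx)).
exact: simplex_mean_le.
Qed.

Lemma simplex_sqr_sum_le1 x : simplex x -> \sum_j x 0 j ^+ 2 <= 1.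
Proof.
move=> sx; under eq_bigr do rewrite expr2.
by apply: simplex_mean_le => // j; exact: simplex_le1.
Qed.

Lemma simplex_sqr_dist_le2 x z : simplex x -> simplex z ->
  \sum_j (x 0 j - z 0 j) ^+ 2 <= 2.
Proof.
move=> sx sz.
apply: (@le_trans _ _ (\sum_j (x 0 j ^+ 2 + z 0 j ^+ 2))).
  apply: ler_sum => j _; rewrite sqrrB.
  have := mulr_ge0 (simplex_ge0 j sx) (simplex_ge0 j sz); lra.
rewrite big_split /=.
by have := lerD (simplex_sqr_sum_le1 sx) (simplex_sqr_sum_le1 sz); lra.
Qed.

(** The excess over 1 / n is the squared distance to the uniform vector. *)
Lemma simplex_sqr_sum_ge x : (0 < n)%N -> simplex x ->
  n%:R^-1 <= \sum_j x 0 j ^+ 2.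
Proof.
move=> n0 [x0 x1].
have nR : n%:R != 0 :> R by rewrite pnatr_eq0 -lt0n.
rewrite -subr_ge0.
have -> : \sum_j x 0 j ^+ 2 - n%:R^-1 = \sum_j (x 0 j - n%:R^-1) ^+ 2.
  set c := n%:R^-1.
  transitivity (\sum_j (x 0 j ^+ 2 + (- (2 * c) * x 0 j + c ^+ 2))); last first.
    by apply: eq_bigr => j _; ring.
  rewrite !big_split /= -mulr_sumr x1 sumr_const card_ord -mulr_natr /c.
  by field.
by apply: sumr_ge0 => j _; exact: sqr_ge0.
Qed.

Lemma simplex_vertex (j : 'I_n) : simplex (delta_mx 0 j : 'rV[R]_n).
Proof.
split=> [i|]; first by rewrite mxE; case: (_ && _); rewrite ?ler01 ?lexx.
rewrite (bigD1 j) //= mxE !eqxx big1 ?addr0 // => i /negbTE ij.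
by rewrite mxE ij andbF.
Qed.

End Simplex.

Section WeightedAverages.
Variable R : realType.

Definition weight_sum (lo hi : nat) : R := \sum_(lo <= t < hi) t%:R.

Lemma weight_sum_gt0 lo hi : (0 < lo)%N -> (lo < hi)%N -> 0 < weight_sum lo hi.
Proof.
move=> lo0 lohi; rewrite /weight_sum big_ltn //.
by rewrite ltr_pwDl ?ltr0n // sumr_ge0.
Qed.

Lemma wavgE (V : lmodType R) lo hi (z : nat -> V) :
  wavg lo hi z = (weight_sum lo hi)^-1 *: \sum_(lo <= t < hi) t%:R *: z t.
Proof.
rewrite scaler_sumr; apply: eq_bigr => t _.
by rewrite scalerA mulrC.
Qed.

(** Appending one time rescales the old average by W / W' and adds the new point
    with the complementary weight, so two-point convexity suffices. *)
Lemma wavg_convex (V : lmodType R) (X : set V) lo hi (z : nat -> V) :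
  convex_closed X -> (0 < lo)%N -> (lo < hi)%N ->
  (forall t, (lo <= t < hi)%N -> X (z t)) -> X (wavg lo hi z).
Proof.
move=> cX lo0 lohi; rewrite wavgE -(subnKC lohi) => {lohi}.
elim: (hi - lo.+1)%N => [|d IH] zX.
  rewrite addn0 /weight_sum !big_nat1 scalerA mulVf ?scale1r; first apply: zX.
    by rewrite addn0 leqnn /=.
  by rewrite pnatr_eq0 -lt0n.
have W0 e : 0 < weight_sum lo (lo.+1 + e).
  by apply: weight_sum_gt0 => //; rewrite addSn ltnS leq_addr.
have zd : X (z (lo.+1 + d)%N).
  by apply: zX; rewrite addSn addnS !addSn -addnS leq_addr /= addnS ltnS.
set W := weight_sum lo (lo.+1 + d); set W' := weight_sum lo (lo.+1 + d.+1).
have WE : W' = W + (lo.+1 + d)%:R.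
  by rewrite /W' /weight_sum addnS big_nat_recr //= addSn -addnS leq_addr.
have t01 : 0 <= W / W' <= 1.
  by rewrite divr_ge0 ?(ltW (W0 _)) //= ler_pdivrMr ?W0 // mul1r WE lerDl ler0n.
rewrite addnS big_nat_recr /=; last by rewrite addSn -addnS leq_addr.
rewrite -/W' scalerDr.
have -> : W'^-1 *: \sum_(lo <= t < lo.+1 + d) t%:R *: z t =
   (W / W') *: (W^-1 *: \sum_(lo <= t < lo.+1 + d) t%:R *: z t).
  by rewrite scalerA mulrAC divff ?mul1r // gt_eqF // W0.
have -> : W'^-1 *: ((lo.+1 + d)%:R *: z (lo.+1 + d)%N) =
   (1 - W / W') *: z (lo.+1 + d)%N.
  rewrite scalerA; congr (_ *: _).
  have : W' != 0 by rewrite gt_eqF // W0.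
  move: WE; move: (lo.+1 + d)%:R W' {t01} => r w' -> w0.
  by field.
apply: cX => //; apply: IH => t /andP[h1 h2].
by apply: zX; rewrite h1 /= addnS (leq_trans h2).
Qed.

End WeightedAverages.

(** * The constants of the proximal setup *)

Section SimplexConstants.
Variables (R : realType) (A : nat).
Implicit Types (x : 'rV[R]_A).

Lemma D_XE (x x' : 'rV[R]_A) : D_X x x' = dotm (x - x') (x - x') / 2.
Proof. by rewrite /D_X sqr_norm2 mulrC. Qed.

Lemma D_X_le1 x x' : simplex x -> simplex x' -> D_X x x' <= 1.
Proof.
move=> sx sx'; rewrite D_XE ler_pdivrMr // mul1r /dotm big_ord1.
apply: le_trans (simplex_sqr_dist_le2 sx sx').
by apply: ler_sum => j _; rewrite -expr2 !mxE.
Qed.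

Lemma D_X_le_Theta x x' : simplex x -> simplex x' -> D_X x x' <= Theta_X R A.
Proof.
move=> sx sx'; apply: ub_le_sup; last by exists x => //; exists x'.
by exists 1 => _ [u su [u' su' <-]]; exact: D_X_le1.
Qed.

Lemma D_X_ge0 x x' : 0 <= D_X x x'.
Proof. by rewrite mulr_ge0 ?invr_ge0 ?sqr_ge0. Qed.

Lemma Theta_X_ge0 : (0 < A)%N -> 0 <= Theta_X R A.
Proof.
move=> A0; have sx := simplex_vertex R (Ordinal A0).
exact: le_trans (D_X_ge0 _ _) (D_X_le_Theta sx sx).
Qed.

(** Two distinct vertices are at distance sqrt 2. *)
Lemma Theta_X_ge1 : (1 < A)%N -> 1 <= Theta_X R A.
Proof.
move=> A1.
set i := Ordinal (ltnW A1); set j := Ordinal A1.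
apply: le_trans (D_X_le_Theta (simplex_vertex R i) (simplex_vertex R j)).
rewrite D_XE ler_pdivlMr // mul1r /dotm big_ord1 (bigD1 i) //= (bigD1 j) //=.
rewrite !mxE !eqxx /= !subr0 sub0r mulrNN !mulr1 addrA lerDl.
by apply: sumr_ge0 => l _; rewrite -expr2 sqr_ge0.
Qed.

Lemma R_X_ge1 : (0 < A)%N -> 1 <= R_X R A.
Proof.
move=> A0.
pose e : 'rV[R]_A := delta_mx 0 (Ordinal A0).
have se : simplex e by exact: simplex_vertex.
apply: (@le_trans _ _ (norm2 e)).
  rewrite -(@ler_pXn2r _ 2) ?nnegrE ?norm2_ge0 // expr1n sqr_norm2.
  rewrite /dotm big_ord1 (bigD1 (Ordinal A0)) //=.
  rewrite !mxE !eqxx mulr1 lerDl.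
  by apply: sumr_ge0 => l _; rewrite -expr2 sqr_ge0.
apply: ub_le_sup; last by exists e.
exists 1 => _ [u su <-].
rewrite -(@ler_pXn2r _ 2) ?nnegrE ?norm2_ge0 // expr1n sqr_norm2 /dotm big_ord1.
by under eq_bigr do rewrite -expr2; exact: simplex_sqr_sum_le1.
Qed.

End SimplexConstants.

(** * Kernels, ambiguity balls and the bilinear game of a state *)

Section Kernels.
Variables (R : realType) (S A N : nat).
Implicit Types (q : 'M[R]_(A, S)) (w y : 'I_N -> 'M[R]_(A, S)).

Lemma kernels_convex : convex_closed (@kernels R A S).
Proof.
move=> t u w t01 ku kw a; have := simplex_convex t01 (ku a) (kw a).
by congr simplex; apply/rowP => j; rewrite !mxE.
Qed.

Lemma kernel_apply_le q (v : 'cV[R]_S) a : kernels q ->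
  `|(q *m v) a 0| <= norminf v.
Proof.
move=> kq; rewrite mxE.
have := simplex_mean_norm_le (kq a) (fun j => le_norminf v j 0).
by under eq_bigr do rewrite mxE.
Qed.

Lemma dotY_inner : @semi_inner R ('I_N -> 'M[R]_(A, S)) (@dotY R S A N).
Proof.
have b := inner_bilin (@dotm_inner R A S).
split=> [|h y|y].
- split=> [a h h' y|a h y y']; rewrite /dotY mulr_sumr -big_split /=;
    apply: eq_bigr => i _.
  + exact: (bilinl b).
  + exact: (bilinr b).
- by apply: eq_bigr => i _; rewrite (innerC (@dotm_inner R A S)).
- by apply: sumr_ge0 => i _; rewrite (inner_ge0 (@dotm_inner R A S)).
Qed.

Lemma D_YE (y y' : 'I_N -> 'M[R]_(A, S)) : D_Y y y' = dotY (y - y') (y - y') / 2.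
Proof.
rewrite /D_Y -mulr_sumr mulrC; congr (_ / _); apply: eq_bigr => i _.
by rewrite sqr_norm2.
Qed.

Lemma kmeanE y a s : kmean y a s = N%:R^-1 * \sum_i y i a s.
Proof. by rewrite mxE summxE. Qed.

Lemma kmean_kernel y :
  (0 < N)%N -> (forall i, kernels (y i)) -> kernels (kmean y).
Proof.
move=> N0 ky a; split=> [j|].
  rewrite mxE kmeanE mulr_ge0 ?invr_ge0 ?ler0n // sumr_ge0 // => i _.
  by have := simplex_ge0 j (ky i a); rewrite mxE.
under eq_bigr do rewrite mxE kmeanE.
rewrite -mulr_sumr exchange_big /=.
have rowsum i : \sum_j y i a j = 1.
  by rewrite -(simplex_sum (ky i a)); apply: eq_bigr => j _; rewrite mxE.
under eq_bigr do rewrite rowsum.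
by rewrite sumr_const card_ord mulVf // pnatr_eq0 -lt0n.
Qed.

Lemma kmean_wavg lo hi (y : nat -> 'I_N -> 'M[R]_(A, S)) :
  kmean (wavgY lo hi y) = wavg lo hi (fun t => kmean (y t)).
Proof.
rewrite /kmean /wavgY /wavg exchange_big /= scaler_sumr.
apply: eq_bigr => t _; rewrite -scaler_sumr !scalerA mulrC //.
Qed.

Lemma wavgYE lo hi (y : nat -> 'I_N -> 'M[R]_(A, S)) :
  wavgY lo hi y = wavg lo hi y.
Proof.
apply/funext => i; rewrite /wavgY /wavg fct_sumE.
by apply: eq_bigr => t _.
Qed.

End Kernels.

Section Model.
Variables (R : realType) (S A N : nat) (M : wdrmdp R S A N).
Notation tuple_of := ('I_N -> 'M[R]_(A, S)).
Notation lam := (disc M).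
Implicit Types (s : 'I_S) (v : 'cV[R]_S) (y w : tuple_of) (x u : 'rV[R]_A).

Let lam_gt0 : 0 < lam := disc_gt0 M.
Let N0 : (0 < N)%N := samples_gt0 M.

Lemma ball_tuple_kernels s y i : ball_tuple M s y -> kernels (y i).
Proof. by case. Qed.

Lemma ball_tuple_convex s : @convex_closed R tuple_of (ball_tuple M s).
Proof.
move=> t u w t01 [ku Bu] [kw Bw]; split=> [i|]; first exact: kernels_convex.
have dc i := dist_convex (metric M) (u i) (w i) (nominal M s i) t01.
case/andP: (t01) => t0 t1; have t1' : 0 <= 1 - t by rewrite subr_ge0.
case: (wass M) Bu Bw => [p|] Bu Bw.
  apply: (@le_trans _ _
    (t * Defs.radius M ^+ p + (1 - t) * Defs.radius M ^+ p)); last first.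
    by rewrite -mulrDl addrC subrK mul1r.
  apply: le_trans (lerD (ler_wpM2l t0 Bu) (ler_wpM2l t1' Bw)).
  rewrite [t * _]mulrCA [(1 - t) * _]mulrCA -mulrDr ler_wpM2l ?invr_ge0 ?ler0n //.
  rewrite !mulr_sumr -big_split /=; apply: ler_sum => i _.
  apply: le_trans (convex_exprn p t0 t1' _ _ _); rewrite ?dist_ge0 //; last first.
    by rewrite addrC subrK.
  rewrite lerXn2r ?nnegrE ?dist_ge0 ?addr_ge0 ?mulr_ge0 ?dist_ge0 //; exact: dc.
move=> i; apply: le_trans (dc i) _.
apply: le_trans (lerD (ler_wpM2l t0 (Bu i)) (ler_wpM2l t1' (Bw i))) _.
by rewrite -mulrDl addrC subrK mul1r.
Qed.

Lemma ball_tuple_nominal s : ball_tuple M s (nominal M s).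
Proof.
split=> [i|]; first exact: nominal_kernel.
case E : (wass M) (wass_ok M) => [p|] /= p1.
  rewrite big1 ?mulr0 ?exprn_ge0 ?radius_ge0 // => i _.
  by rewrite distxx expr0n gtn_eqF.
by move=> i; rewrite distxx radius_ge0.
Qed.

Lemma ball_mean_kernels s q : ball_mean M s q -> kernels q.
Proof.
by case=> y By <-; apply: kmean_kernel => // i; exact: ball_tuple_kernels By.
Qed.

(** The part of [Fop] that depends on the kernels; the rest is linear in x. *)
Definition coupling v (x : 'rV[R]_A) (y : tuple_of) : R :=
  lam * \sum_a x 0 a * (kmean y *m v) a 0.

Lemma coupling_bilin v : bilinear_form (coupling v).
Proof.
have kD a y y' : kmean (a *: y + y' : tuple_of) = a *: kmean y + kmean y'.
  rewrite /kmean scalerA mulrC -scalerA -scalerDr; congr (_ *: _).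
  by rewrite scaler_sumr -big_split.
split=> [a u u' w|a u w w']; rewrite /coupling mulrCA -mulrDr; congr (_ * _);
    rewrite mulr_sumr -big_split; apply: eq_bigr => b _ /=.
  by rewrite !mxE mulrDl mulrA.
by rewrite kD mulmxDl -scalemxAl mxE mxE; ring.
Qed.

Lemma Fop_coupling s x y v :
  Fop M s x (kmean y) v = \sum_a x 0 a * cost M s a + coupling v x y.
Proof.
rewrite /Fop /coupling mulr_sumr -big_split; apply: eq_bigr => a _ /=.
ring.
Qed.

Lemma grad_x_dot tau s y v x :
  dotm (tau *: grad_x M s y v) x =
  tau * (\sum_a x 0 a * cost M s a + coupling v x y).
Proof.
rewrite -Fop_coupling /dotm big_ord1 /Fop mulr_sumr; apply: eq_bigr => a _.
rewrite !mxE -mulrA; congr (_ * _); rewrite mulrC; congr (_ * (_ + _ * _)).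
under eq_bigr do rewrite mxE; rewrite exchange_big /= mulr_sumr.
by apply: eq_bigr => j _; rewrite kmeanE -mulrA mulr_suml.
Qed.

Lemma grad_y_dot sigma v x x1 y :
  dotY (fun i => sigma *: grad_y M x1 x v i) y =
  sigma * coupling v (2 *: x1 - x) y.
Proof.
rewrite /dotY /coupling /dotm mulrCA !mulr_sumr exchange_big /=.
apply: eq_bigr => a _; rewrite exchange_big /=.
rewrite !mxE !mulr_sumr; apply: eq_bigr => j _.
rewrite kmeanE mulr_sumr !(mulr_suml, mulr_sumr); apply: eq_bigr => i _.
rewrite !mxE; ring.
Qed.

Lemma step_x_gt0 v : v != 0 -> 0 < step_x M v.
Proof.
move=> v0; rewrite invr_gt0 !mulr_gt0 ?norm2_gt0 // sqrtr_gt0 ltr0n.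
exact: actions_gt0 M.
Qed.

Lemma step_y_gt0 v : v != 0 -> 0 < step_y M v.
Proof.
move=> v0; rewrite !mulr_gt0 ?invr_gt0 ?mulr_gt0 ?norm2_gt0 ?ltr0n //.
by rewrite sqrtr_gt0 ltr0n; exact: actions_gt0 M.
Qed.

(** This is tau sigma |K|^2 <= 1 in its usable form. Each term of the triple sum
    is bounded by p q <= (r/n) p^2 / 2 + (n/r) q^2 / 2 with r = sqrt A and
    n = |v|_2, and the step sizes are such that the squares sum to the right-hand
    side. *)
Lemma coupling_le v u w : v != 0 ->
  coupling v u w <= dotm u u / 2 / step_x M v + dotY w w / 2 / step_y M v.
Proof.
move=> v0; pose n := norm2 v; pose r : R := Num.sqrt A%:R.
have n0 : 0 < n by exact: norm2_gt0.
have r0 : 0 < r by rewrite sqrtr_gt0 ltr0n; exact: actions_gt0 M.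
have NR : 0 < N%:R :> R by rewrite ltr0n.
have vv : \sum_j v j 0 ^+ 2 = n ^+ 2.
  rewrite sqr_norm2 /dotm; apply: eq_bigr => j _; by rewrite big_ord1.
have -> : coupling v u w =
    \sum_i \sum_a \sum_j lam / N%:R * ((u 0 a * v j 0) * w i a j).
  rewrite /coupling mulr_sumr exchange_big /=; apply: eq_bigr => a _.
  rewrite exchange_big /= mxE mulrA mulr_sumr; apply: eq_bigr => j _.
  rewrite kmeanE !(mulr_suml, mulr_sumr); apply: eq_bigr => i _; ring.
have -> : dotm u u / 2 / step_x M v =
    \sum_(i < N) \sum_a \sum_j lam / N%:R * (r / n / 2 * (u 0 a * v j 0) ^+ 2).
  rewrite sumr_const card_ord -[RHS]mulr_natr /dotm big_ord1 !mulr_suml.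
  apply: eq_bigr => a _.
  have -> : \sum_j lam / N%:R * (r / n / 2 * (u 0 a * v j 0) ^+ 2) =
      lam / N%:R * (r / n / 2 * (u 0 a ^+ 2 * n ^+ 2)).
    by rewrite -vv !mulr_sumr; apply: eq_bigr => j _; rewrite exprMn.
  rewrite /step_x -/n -/r; field.
  by rewrite !gt_eqF.
have -> : dotY w w / 2 / step_y M v =
    \sum_i \sum_a \sum_j lam / N%:R * (n / r / 2 * w i a j ^+ 2).
  rewrite /dotY !mulr_suml; apply: eq_bigr => i _.
  rewrite /dotm !mulr_suml; apply: eq_bigr => a _.
  rewrite !mulr_suml; apply: eq_bigr => j _.
  rewrite /step_y -/n -/r; field.
  by rewrite !gt_eqF.
rewrite -big_split; apply: ler_sum => i _.
rewrite -big_split; apply: ler_sum => a _.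
rewrite -big_split; apply: ler_sum => j _ /=.
rewrite -mulrDr ler_wpM2l ?divr_ge0 ?(ltW lam_gt0) ?(ltW NR) //.
move: (u 0 a * v j 0) (w i a j) => p q.
rewrite -subr_ge0.
have -> : r / n / 2 * p ^+ 2 + n / r / 2 * q ^+ 2 - p * q =
   (r / n / 2) * (p - n / r * q) ^+ 2.
  by field; rewrite !gt_eqF.
by rewrite mulr_ge0 ?sqr_ge0 // !divr_ge0 ?(ltW r0) ?(ltW n0).
Qed.

Lemma D_Y_le_Theta s y y' : ball_tuple M s y -> ball_tuple M s y' ->
  D_Y y y' <= Theta_Y M.
Proof.
move=> By By'; apply: le_trans (le_bigmax _ _ s).
apply: ub_le_sup; last by exists y => //; exists y'.
exists (\sum_(i < N) 2^-1 * \sum_(a < A) 2) => _ [u Bu [u' Bu' <-]].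
apply: ler_sum => i _; rewrite ler_wpM2l ?invr_ge0 // sqr_norm2.
apply: ler_sum => a _.
apply: le_trans (simplex_sqr_dist_le2 (ball_tuple_kernels i Bu a)
                                      (ball_tuple_kernels i Bu' a)).
by apply: ler_sum => j _; rewrite -expr2 !mxE.
Qed.

Lemma Theta_Y_ge0 : 0 <= Theta_Y M.
Proof. exact: bigmax_ge_id. Qed.

(** Already the nominal tuple has squared norm at least N A / S. *)
Lemma scaled_R_Y_ge1 : 1 <= Num.sqrt S%:R / Num.sqrt N%:R * R_Y M.
Proof.
have SR : 0 < S%:R :> R by rewrite ltr0n (states_gt0 M).
have NR : 0 < N%:R :> R by rewrite ltr0n.
pose s := Ordinal (states_gt0 M); pose y : tuple_of := nominal M s.
have By : ball_tuple M s y by exact: ball_tuple_nominal.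
have ley : normY y <= R_Y M.
  apply: le_trans (le_bigmax _ _ s); apply: ub_le_sup; last by exists y.
  exists (Num.sqrt (\sum_(i < N) \sum_(a < A) 1)) => _ [w Bw <-].
  apply: ler_wsqrtr; apply: ler_sum => i _; apply: ler_sum => a _.
  apply: le_trans (simplex_sqr_sum_le1 (ball_tuple_kernels i Bw a)).
  by apply: ler_sum => j _; rewrite -expr2 mxE.
apply: le_trans (ler_wpM2l _ ley); last by rewrite divr_ge0 ?sqrtr_ge0.
rewrite mulrAC ler_pdivlMr ?sqrtr_gt0 // mul1r -sqrtrM ?ler0n //.
apply: ler_wsqrtr.
have : \sum_(i < N) \sum_(a < A) S%:R^-1 <= dotY y y.
  apply: ler_sum => i _; apply: ler_sum => a _.
  apply: le_trans
    (simplex_sqr_sum_ge (states_gt0 M) (ball_tuple_kernels i By a)) _.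
  by apply: ler_sum => j _; rewrite -expr2 mxE.
move=> /(ler_wpM2l (ltW SR)); apply: le_trans.
rewrite !sumr_const !card_ord -mulrnA -[_ *+ (A * N)]mulr_natr mulVKf ?gt_eqF //.
by rewrite ler_nat leq_pmull // (actions_gt0 M).
Qed.

Lemma Fop_lipschitz s x q v v' : simplex x -> kernels q ->
  `|Fop M s x q v - Fop M s x q v'| <= lam * norminf (v - v').
Proof.
move=> sx kq; rewrite /Fop -sumrB.
under eq_bigr do rewrite -mulrBr.
apply: simplex_mean_norm_le => // a.
rewrite opprD addrACA subrr add0r -mulrBr normrM (ger0_norm (ltW lam_gt0)).
rewrite ler_wpM2l ?(ltW lam_gt0) //.
have -> : (q *m v) a 0 - (q *m v') a 0 = (q *m (v - v')) a 0.
  by rewrite mulmxBr !mxE.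
exact: kernel_apply_le.
Qed.

Lemma Fop_bound s x q v : simplex x -> kernels q ->
  `|Fop M s x q v| <= norminf (cost M) + lam * norminf v.
Proof.
move=> sx kq; apply: simplex_mean_norm_le => // a.
apply: le_trans (ler_normD _ _) _; rewrite lerD ?le_norminf //.
rewrite normrM (ger0_norm (ltW lam_gt0)) ler_wpM2l ?(ltW lam_gt0) //.
exact: kernel_apply_le.
Qed.

(** The payoff is linear in x and affine in the kernel, so weighted averages pass
    through it. *)
Lemma Fop_wavg_gap lo hi s (xs : nat -> 'rV[R]_A) (qs : nat -> 'M[R]_(A, S))
    x' q' v : (0 < lo)%N -> (lo < hi)%N ->
  weight_sum R lo hi *
    (Fop M s (wavg lo hi xs) q' v - Fop M s x' (wavg lo hi qs) v)
  = \sum_(lo <= t < hi) t%:R * (Fop M s (xs t) q' v - Fop M s x' (qs t) v).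
Proof.
move=> lo0 lohi; set W := weight_sum R lo hi.
have W0 : W != 0 by rewrite gt_eqF ?weight_sum_gt0.
under [RHS]eq_bigr do rewrite mulrBr.
rewrite mulrBr sumrB; congr (_ - _).
  rewrite /Fop mulr_sumr; under [RHS]eq_bigr do rewrite mulr_sumr.
  rewrite exchange_big; apply: eq_bigr => a _ /=.
  rewrite wavgE mxE summxE mulrA mulrA divff // mul1r mulr_suml.
  by apply: eq_bigr => t _; rewrite mxE mulrA.
rewrite /Fop mulr_sumr; under [RHS]eq_bigr do rewrite mulr_sumr.
rewrite exchange_big; apply: eq_bigr => a _ /=.
under eq_bigr do rewrite mulrCA mulrDr.
rewrite -mulr_sumr big_split /= -mulr_suml -/(weight_sum R lo hi) -/W mulrCA.
congr (_ * _); rewrite mulrDr; congr (_ + _).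
rewrite wavgE -/W -scalemxAl mxE mulrCA mulVKf // mulmx_suml summxE mulr_sumr.
by apply: eq_bigr => t _; rewrite -scalemxAl mxE mulrCA.
Qed.

End Model.

(** * Sums along a perturbed geometric recursion *)

Lemma binD_le_expn (i d : nat) : ('C(i + d, d) <= i.+1 ^ d)%N.
Proof.
elim: d => [|d IH]; first by rewrite bin0.
rewrite -(@leq_pmul2l d.+1) // addnS -mul_bin_diag expnS.
apply: leq_trans (leq_mul (leqnn _) IH) _.
rewrite mulnA leq_mul2r; apply/orP; right; nia.
Qed.

Lemma expn_le_binD (i d : nat) : (i.+1 ^ d <= d`! * 'C(i + d, d))%N.
Proof.
elim: d => [|d IH]; first by rewrite bin0.
rewrite expnS factS [(d.+1 * _)%N]mulnC -mulnA (addnS i) -mul_bin_diag mulnCA.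
by apply: leq_mul; rewrite // ltnS leq_addr.
Qed.

(** Powers are traded for binomial weights 'C(i + d, d), on which Pascal's rule
    acts exactly: shifting the index of the degree d + 1 sum produces the
    degree d sum, and the shifted terms are controlled by the recursion. Each
    degree thus costs one factor 1 / (1 - rho). *)
Section GeometricRecursion.
Variables (R : realFieldType) (rho e : R) (delta : nat -> R) (n : nat).
Hypotheses (rho_ge0 : 0 <= rho) (rho_lt1 : rho < 1) (e_ge0 : 0 <= e).
Hypothesis delta_ge0 : forall i, 0 <= delta i.
Hypothesis delta_rec : forall i, (i.+1 < n)%N ->
  delta i.+1 <= rho * delta i + e / i.+1%:R ^+ 2.
Hypothesis n_gt0 : (0 < n)%N.

Let H (d : nat) : R := \sum_(0 <= i < n) 'C(i + d, d)%:R * delta i.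
Let noise : R := e * n%:R ^+ 4.

Let binomial_tail (d : nat) : (d <= 5)%N ->
  \sum_(0 <= i < n.-1) 'C(i + d, d)%:R * delta i.+1 <= rho * H d + noise.
Proof.
move=> d5.
have step i : (i < n.-1)%N -> 'C(i + d, d)%:R * delta i.+1
    <= rho * ('C(i + d, d)%:R * delta i) + e * n%:R ^+ 3.
  move=> i_lt; have /delta_rec Hi : (i.+1 < n)%N by lia.
  apply: le_trans (ler_wpM2l (ler0n _ _) Hi) _.
  rewrite mulrDr mulrCA lerD2l mulrCA ler_wpM2l //.
  rewrite ler_pdivrMr ?exprn_gt0 ?ltr0n // -!natrX -natrM ler_nat.
  apply: leq_trans (binD_le_expn i d) _.
  apply: (@leq_trans (i.+1 ^ 5)); first by rewrite leq_pexp2l.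
  by rewrite (expnD _ 3 2) leq_mul2r leq_exp2r //; apply/orP; right; lia.
apply: (@le_trans _ _ (\sum_(0 <= i < n.-1)
    (rho * ('C(i + d, d)%:R * delta i) + e * n%:R ^+ 3))).
  by apply: ler_sum_nat => i /andP[_]; exact: step.
rewrite big_split /= -mulr_sumr lerD //.
  rewrite ler_wpM2l // /H -[in leRHS](prednK n_gt0) big_nat_recr //=.
  by rewrite lerDl mulr_ge0 ?ler0n.
rewrite sumr_const_nat subn0 -[leLHS]mulr_natr -mulrA ler_wpM2l // [leRHS]exprSr.
by rewrite ler_wpM2l ?exprn_ge0 ?ler0n // ler_nat leq_pred.
Qed.

Let binomial_sum_rec (d : nat) : (d < 5)%N ->
  (1 - rho) * H d.+1 <= H d + noise.
Proof.
move=> d5; have := binomial_tail d5.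
have -> : \sum_(0 <= i < n.-1) 'C(i + d.+1, d.+1)%:R * delta i.+1 = H d.+1 - H d.
  rewrite /H -(prednK n_gt0) !(big_nat_recl _ _ _ (leq0n _)) /= !add0n !binn.
  rewrite opprD addrACA subrr add0r -sumrB; apply: eq_bigr => i _.
  rewrite -mulrBl; congr (_ * _); rewrite addSn binS addnS natrD addrK //.
by lra.
Qed.

Let binomial_sum0 : (1 - rho) * H 0 <= delta 0%N + noise.
Proof.
have := binomial_tail (leq0n _).
have -> : \sum_(0 <= i < n.-1) 'C(i + 0, 0)%:R * delta i.+1 = H 0 - delta 0%N.
  rewrite /H -(prednK n_gt0) (big_nat_recl _ _ _ (leq0n _)) /= bin0 mul1r.
  rewrite addrAC subrr add0r; by apply: eq_bigr => i _; rewrite !bin0.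
by lra.
Qed.

Lemma sum_pow5_geometric_recursion :
  \sum_(0 <= i < n) i.+1%:R ^+ 5 * delta i
  <= 120 * (1 - rho)^-1 ^+ 6 * (delta 0%N + 6 * e * n%:R ^+ 4).
Proof.
set a := (1 - rho)^-1.
have r0 : 0 < 1 - rho by rewrite subr_gt0.
have a0 : 0 <= a by rewrite invr_ge0 ltW.
have a1 : 1 <= a by rewrite -[leLHS]invr1 lef_pV2 ?posrE // gerBl.
have noise0 : 0 <= noise by rewrite mulr_ge0 // exprn_ge0.
have Hd d : (d <= 5)%N -> H d <= a ^+ d.+1 * (delta 0%N + d.+1%:R * noise).
  elim: d => [_|d IH d5].
    by rewrite expr1 mul1r mulrC ler_pdivlMr // mulrC binomial_sum0.
  have := binomial_sum_rec d5; rewrite mulrC -ler_pdivlMr // => /le_trans; apply.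
  rewrite mulrC exprS -mulrA ler_wpM2l //.
  have {}IH := IH (ltnW d5).
  have : noise <= a ^+ d.+1 * noise by rewrite ler_peMl // exprn_ege1.
  rewrite -(natr1 d.+1); move: IH; move: (a ^+ d.+1) => p; lra.
apply: (@le_trans _ _ (120 * H 5)).
  rewrite /H mulr_sumr; apply: ler_sum => i _.
  rewrite mulrA ler_wpM2r // -natrX -natrM ler_nat.
  exact: (expn_le_binD i 5).
have := Hd 5%N (leqnn _); rewrite /noise; move: (a ^+ 6) => p.
by move=> h; lra.
Qed.

End GeometricRecursion.

(** * Epochs and total time *)

Lemma weight_sumE (R : realType) (a d : nat) :
  2 * weight_sum R a.+1 (a + d).+1 = d%:R * (a%:R + (a + d).+1%:R).
Proof.
elim: d => [|d IH].
  by rewrite addn0 /weight_sum big_geq // mulr0 mul0r.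
rewrite /weight_sum addnS big_nat_recr /=; last by rewrite ltnS leq_addr.
rewrite mulrDr IH -!natr1 natrD; ring.
Qed.

Lemma epoch_start1 : epoch_start 1 = 0%N.
Proof. by rewrite /epoch_start big_geq. Qed.

Lemma epoch_startS l : (1 <= l)%N -> epoch_start l.+1 = (epoch_start l + l ^ 2)%N.
Proof. by move=> l1; rewrite /epoch_start big_nat_recr. Qed.

Lemma epoch_start_le l : (epoch_start l.+1 <= l ^ 3)%N.
Proof.
elim: l => [|l IH]; first by rewrite epoch_start1.
rewrite epoch_startS //; apply: leq_trans (leq_add IH (leqnn _)) _; nia.
Qed.

Lemma epoch_start_ge l : (l ^ 3 <= 3 * epoch_start l.+1)%N.
Proof.
elim: l => [|l IH]; first by rewrite epoch_start1.
by rewrite epoch_startS //; nia.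
Qed.

Lemma epoch_of k t : (t < epoch_start k.+1)%N ->
  exists2 l, (1 <= l <= k)%N & (epoch_start l <= t < epoch_start l + l ^ 2)%N.
Proof.
elim: k => [|k IH]; first by rewrite epoch_start1.
have [tk|kt] := ltnP t (epoch_start k.+1).
  move=> _; have [l /andP[l1 lk] ht] := IH tk; exists l => //.
  by rewrite l1 (leq_trans lk).
rewrite epoch_startS // => tk; exists k.+1; first by rewrite leqnn.
by rewrite kt.
Qed.

Lemma sum_over_epochs (R : realType) (k : nat) (f : nat -> R) :
  \sum_(1 <= t < (epoch_start k.+1).+1) f t =
  \sum_(1 <= l < k.+1)
    \sum_((epoch_start l).+1 <= t < (epoch_start l + l ^ 2).+1) f t.
Proof.
elim: k => [|k IH]; first by rewrite epoch_start1 !big_geq.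
rewrite [RHS]big_nat_recr //= -IH epoch_startS //.
by rewrite -big_cat_nat //= ltnS leq_addr.
Qed.

(** * The robust value and the duality gap *)

Section Value.
Variables (R : realType) (S A N : nat) (M : wdrmdp R S A N) (vstar : 'cV[R]_S).
Hypothesis vstar_value : is_value M vstar.
Notation lam := (disc M).
Notation gap s v x q x' q' := (Fop M s x q' v - Fop M s x' q v).

Let payoffs s x := [set Fop M s x q vstar | q in ball_mean M s].

Lemma payoffs_nonempty s x : payoffs s x !=set0.
Proof.
exists (Fop M s x (kmean (nominal M s)) vstar), (kmean (nominal M s)) => //.
by exists (nominal M s) => //; exact: ball_tuple_nominal.
Qed.

Lemma payoffs_ubound s x : simplex x -> has_ubound (payoffs s x).
Proof.
move=> sx; exists (norminf (cost M) + lam * norminf vstar).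
move=> _ [q /ball_mean_kernels kq <-].
exact: le_trans (ler_norm _) (Fop_bound M s vstar sx kq).
Qed.

Lemma value_le s x b : simplex x ->
  (forall q, ball_mean M s q -> Fop M s x q vstar <= b) -> vstar s 0 <= b.
Proof.
move=> sx xb; rewrite vstar_value; apply: (@le_trans _ _ (sup (payoffs s x))).
  apply: ge_inf; last by exists x.
  exists (- (norminf (cost M) + lam * norminf vstar)) => _ [z sz <-].
  have [q Bq] : ball_mean M s !=set0.
    exists (kmean (nominal M s)), (nominal M s) => //.
    exact: ball_tuple_nominal.
  apply: (@le_trans _ _ (Fop M s z q vstar)).
    have := Fop_bound M s vstar sz (ball_mean_kernels Bq).
    by rewrite ler_norml => /andP[].
  by apply: ub_le_sup (payoffs_ubound s sz) _ _; exists q.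
apply: ge_sup (payoffs_nonempty s x) _ => _ [q Bq <-]; exact: xb.
Qed.

Lemma value_ge s q b : ball_mean M s q ->
  (forall x, simplex x -> b <= Fop M s x q vstar) -> b <= vstar s 0.
Proof.
move=> Bq xb; rewrite vstar_value; apply: lb_le_inf.
  pose e := delta_mx 0 (Ordinal (actions_gt0 M)) : 'rV[R]_A.
  by exists (sup (payoffs s e)), e => //; exact: simplex_vertex.
move=> _ [x sx <-]; apply: le_trans (xb x sx) _.
by apply: ub_le_sup (payoffs_ubound s sx) _ _; exists q.
Qed.

(** A pair with gap e for w has payoff within e of the saddle value for w, and
    the saddle value is lambda-Lipschitz in w. Both facts are used at once by
    playing x, respectively q, in the game of vstar. *)
Lemma approx_value_step s x q w e : simplex x -> ball_mean M s q ->
  (forall x' q', simplex x' -> ball_mean M s q' -> gap s w x q x' q' <= e) ->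
  `|Fop M s x q w - vstar s 0| <= lam * norminf (w - vstar) + e.
Proof.
move=> sx Bq gap_e.
have lip x' q' : simplex x' -> ball_mean M s q' ->
    `|Fop M s x' q' w - Fop M s x' q' vstar| <= lam * norminf (w - vstar).
  by move=> sx' /ball_mean_kernels; exact: Fop_lipschitz.
rewrite ler_norml; apply/andP; split.
  rewrite lerBrDl addrC -lerBrDl opprK; apply: (value_le sx) => q' Bq'.
  have := gap_e _ _ sx Bq'; have := lip _ _ sx Bq'; rewrite ler_norml => /andP[].
  lra.
rewrite lerBlDl addrC -lerBlDl; apply: (value_ge Bq) => x' sx'.
have := gap_e _ _ sx' Bq; have := lip _ _ sx' Bq; rewrite ler_norml => /andP[].
lra.
Qed.

Lemma norminf_value_le : (1 - lam) * norminf vstar <= norminf (cost M).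
Proof.
set b := norminf (cost M) + lam * norminf vstar.
have b0 : 0 <= b by rewrite addr_ge0 ?mulr_ge0 ?norminf_ge0 ?(ltW (disc_gt0 M)).
suff : norminf vstar <= b by rewrite /b; lra.
apply: norminf_le => // s j; rewrite (ord1 j) ler_norml; apply/andP; split.
  have Bn : ball_mean M s (kmean (nominal M s)).
    by exists (nominal M s) => //; exact: ball_tuple_nominal.
  apply: (value_ge Bn) => x sx.
  have := Fop_bound M s vstar sx (ball_mean_kernels Bn).
  by rewrite ler_norml => /andP[].
apply: (value_le (simplex_vertex R (Ordinal (actions_gt0 M)))) => q Bq.
apply: le_trans (ler_norm _) (Fop_bound M s vstar _ (ball_mean_kernels Bq)).
exact: simplex_vertex.
Qed.

Lemma duality_gap_le xb yb b :
  (forall s x' q', simplex x' -> ball_mean M s q' ->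
     gap s vstar (xb s) (yb s) x' q' <= b) ->
  duality_gap M xb yb vstar <= b.
Proof.
move=> gap_b; apply: ge_sup; first by eexists; exists (Ordinal (states_gt0 M)).
move=> _ [s _ <-]; rewrite lerBlDr; apply: ge_sup (payoffs_nonempty s _) _.
move=> _ [q' Bq' <-]; rewrite -lerBlDl; apply: lb_le_inf.
  pose e := delta_mx 0 (Ordinal (actions_gt0 M)) : 'rV[R]_A.
  by exists (Fop M s e (yb s) vstar), e => //; exact: simplex_vertex.
move=> _ [x' sx' <-]; have := gap_b s x' q' sx' Bq'; lra.
Qed.

End Value.

(** * Analysis of a run *)

Section Run.
Variables (R : realType) (S A N : nat) (M : wdrmdp R S A N) (k : nat).
Variables (x : nat -> 'I_S -> 'rV[R]_A) (y : nat -> 'I_S -> ktuple R S A N).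
Variables (v : nat -> 'cV[R]_S).
Hypothesis run : FOM_run M k x y v.
Notation lam := (disc M).
Notation Theta := (Theta_step M k v).
Notation T := (epoch_start k.+1).
Notation lo l := (epoch_start l).+1.
Notation hi l := (epoch_start l + l ^ 2).+1.

Lemma iterates_feasible t s : (t <= T)%N ->
  simplex (x t s) /\ ball_tuple M s (y t s).
Proof.
case: t => [_|t tT]; first by split; [exact: (run_x0 run)|exact: (run_y0 run)].
have [l lk tl] := epoch_of tT.
by split; [case: (run_x run s lk tl)|case: (run_y run s lk tl)].
Qed.

Lemma epoch_Theta_le l : (1 <= l <= k)%N ->
  Theta_X R A / step_x M (v l) + Theta_Y M / step_y M (v l) <= Theta.
Proof.
move=> lk; apply: (le_bigmax_seq 0 l predT) => //.
by rewrite mem_index_iota ltnS.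
Qed.

Lemma Theta_step_ge0 : 0 <= Theta.
Proof. exact: bigmax_ge_id. Qed.

Lemma epoch_start_mono l : (1 <= l <= k)%N -> (epoch_start l + l ^ 2 <= T)%N.
Proof.
move=> /andP[l1 lk]; rewrite -epoch_startS //.
by rewrite /epoch_start [leqRHS](@big_cat_nat _ _ _ l.+1) //= leq_addr.
Qed.

(** The energies of the epoch lie between 0 and 2 Theta, the upper bound using
    [coupling_le] at -(x' - x_t) to bound the cross term from below. *)
Lemma epoch_weighted_gap l s x' y' : (1 <= l <= k)%N ->
  simplex x' -> ball_tuple M s y' ->
  \sum_(lo l <= t < hi l)
    t%:R * (Fop M s (x t s) (kmean y') (v l) - Fop M s x' (kmean (y t s)) (v l))
  <= (epoch_start l + l ^ 2)%:R * (2 * Theta).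
Proof.
move=> lk sx' By'; have v0 := run_v_neq0 run lk.
have tau0 := step_x_gt0 M v0; have sigma0 := step_y_gt0 M v0.
set a := epoch_start l; set d := (l ^ 2)%N.
pose c (z : 'rV[R]_A) : R := \sum_a z 0 a * cost M s a.
pose E := pd_energy (@dotm R 1 A) (@dotY R S A N) (coupling M (v l))
  (step_x M (v l)) (step_y M (v l)).
have E_ge0 u w : 0 <= E u w by rewrite subr_ge0 coupling_le.
pose V t := E (x' - x t s) ((y' : 'I_N -> _) - y t s).
have V_le t : (t <= a + d)%N -> V t <= 2 * Theta.
  move=> tl; have /(iterates_feasible s)[sx By] : (t <= T)%N.
    exact: leq_trans tl (epoch_start_mono lk).
  have h1 : dotm (x' - x t s) (x' - x t s) / 2 / step_x M (v l)
      <= Theta_X R A / step_x M (v l).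
    by rewrite ler_pdivrMr // divfK ?gt_eqF // -D_XE; exact: D_X_le_Theta.
  have h2 : dotY ((y' : 'I_N -> _) - y t s) ((y' : 'I_N -> _) - y t s) / 2
      / step_y M (v l) <= Theta_Y M / step_y M (v l).
    by rewrite ler_pdivrMr // divfK ?gt_eqF // -D_YE; exact: D_Y_le_Theta By' By.
  have := coupling_le M (- (x' - x t s)) ((y' : 'I_N -> _) - y t s) v0.
  have dN : dotm (- (x' - x t s)) (- (x' - x t s))
      = dotm (x' - x t s) (x' - x t s).
    have b := inner_bilin (@dotm_inner R 1 A).
    by rewrite (bilinNl b) (bilinNr b) opprK.
  rewrite dN (bilinNl (coupling_bilin M (v l))).
  have := epoch_Theta_le lk; rewrite /V /E /pd_energy; move: h1 h2.
  move: (dotm _ _ / 2 / _) (dotY _ _ / 2 / _) (coupling _ _ _ _).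
  move: (Theta_X R A / _) (Theta_Y M / _) Theta => *; lra.
have step t : (a <= t < a + d)%N ->
    Fop M s (x t.+1 s) (kmean y') (v l) - Fop M s x' (kmean (y t.+1 s)) (v l)
    <= V t - V t.+1.
  move=> tl; have [xX xmin] := run_x run s lk tl.
  have [yY ymax] := run_y run s lk tl.
  rewrite !Fop_coupling.
  have := @primal_dual_step _ _ _ _ _ _ c _ _ _ _ (@dotm_inner R 1 A)
    (@dotY_inner R S A N) (coupling_bilin M (v l)) (@simplex_convex R A)
    (@ball_tuple_convex _ _ _ _ M s) tau0 sigma0
    (x t s) (x t.+1 s) x' (y t s) (y t.+1 s) y'
    (step_x M (v l) *: grad_x M s (y t s) (v l))
    (fun i => step_y M (v l) *: grad_y M (x t.+1 s) (x t s) (v l) i)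
    xX yY sx' By'.
  have hg z := grad_x_dot M (step_x M (v l)) s (y t s) (v l) z.
  have hh z := grad_y_dot M (step_y M (v l)) (v l) (x t s) (x t.+1 s) z.
  move=> /(_ hg hh) H.
  apply: le_trans (H _ _) _.
  - by move=> z sz; rewrite -!D_XE; exact: xmin.
  - by move=> z Bz; rewrite -!D_YE; exact: ymax.
  - by rewrite lerBlDr lerDl E_ge0.
rewrite big_add1 /=.
have := @weighted_telescope _ V (2 * Theta) a d.
have VB t : (a <= t < a + d)%N -> V t <= 2 * Theta.
  by move=> /andP[_ /ltnW]; exact: V_le.
move=> /(_ VB (V_le a (leq_addr _ _))); apply: le_trans.
rewrite -[leLHS]addr0 lerD ?mulr_ge0 ?E_ge0 //.
by apply: ler_sum_nat => t tl; rewrite ler_wpM2l // step.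
Qed.

(** The weights of an epoch of l^2 steps sum to at least l^2 / 2 times its last
    time, which cancels the factor in [epoch_weighted_gap]. *)
Lemma epoch_avg_gap l s x' q' : (1 <= l <= k)%N ->
  simplex x' -> ball_mean M s q' ->
  Fop M s (wavg (lo l) (hi l) (x ^~ s)) q' (v l)
    - Fop M s x' (kmean (wavgY (lo l) (hi l) (y ^~ s))) (v l)
  <= 4 * Theta / l%:R ^+ 2.
Proof.
move=> lk sx' [y' By' <-]; have /andP[l1 _] := lk.
have l2 : (0 < l ^ 2)%N by rewrite expn_gt0 l1.
have lohi : (lo l < hi l)%N by rewrite ltnS -[ltnLHS]addn0 ltn_add2l.
have W0 : 0 < weight_sum R (lo l) (hi l) by exact: weight_sum_gt0.
rewrite kmean_wavg -(ler_pM2l W0) Fop_wavg_gap //.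
apply: le_trans (epoch_weighted_gap lk sx' By') _.
have lR : 0 < l%:R ^+ 2 :> R by rewrite exprn_gt0 // ltr0n.
rewrite [leRHS]mulrA ler_pdivlMr //.
have WE := weight_sumE R (epoch_start l) (l ^ 2).
rewrite natrX in WE.
have hi_ge : (epoch_start l + l ^ 2)%:R <= (epoch_start l)%:R + (hi l)%:R :> R.
  by rewrite -natrD ler_nat; lia.
have := ler_wpM2l (ltW lR) hi_ge; rewrite -WE => H.
have := ler_wpM2r (mulr_ge0 (ler0n _ 2) Theta_step_ge0) H.
lra.
Qed.

Lemma epoch_weight_le l : (1 <= l)%N ->
  weight_sum R (lo l) (hi l) <= l%:R ^+ 5.
Proof.
move=> l1; rewrite -(ler_pM2l (ltr0Sn R 1)) weight_sumE natrX.
rewrite (exprD _ 2 3) mulrCA ler_wpM2l ?exprn_ge0 ?ler0n //.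
rewrite -natrX -natrM -natrD ler_nat.
have := epoch_start_le l; rewrite epoch_startS //.
have : (1 <= l ^ 2)%N by rewrite expn_gt0 l1.
lia.
Qed.

Variable vstar : 'cV[R]_S.
Hypothesis vstar_value : is_value M vstar.
Let delta l := norminf (v l.+1 - vstar).

Lemma value_error_rec l : (l.+1 < k)%N ->
  delta l.+1 <= lam * delta l + 4 * Theta / l.+1%:R ^+ 2.
Proof.
move=> lk; have l1k : (1 <= l.+1 <= k)%N by exact: ltnW.
apply: norminf_le => [|s j].
  by rewrite addr_ge0 ?divr_ge0 ?mulr_ge0 ?exprn_ge0 ?norminf_ge0
     ?Theta_step_ge0 ?(ltW (disc_gt0 M)).
rewrite (ord1 j) mxE [(- vstar) _ _]mxE (run_v run s l1k).
have lohi : (lo l.+1 < hi l.+1)%N.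
  by rewrite ltnS -[ltnLHS]addn0 ltn_add2l expn_gt0.
have tT t : (lo l.+1 <= t < hi l.+1)%N -> (t <= T)%N.
  by move=> /andP[_]; rewrite ltnS => /leq_trans; apply; exact: epoch_start_mono.
apply: approx_value_step => //.
- apply: wavg_convex => //; first exact: simplex_convex.
  by move=> t /tT /(iterates_feasible s)[].
- exists (wavgY (lo l.+1) (hi l.+1) (y ^~ s)) => //; rewrite wavgYE.
  apply: (@wavg_convex R ('I_N -> 'M[R]_(A, S)) (ball_tuple M s)) => //.
    exact: ball_tuple_convex.
  by move=> t /tT /(iterates_feasible s)[].
- by move=> x' q' sx' Bq'; exact: epoch_avg_gap.
Qed.

(** Inside epoch l the game of vstar is compared with the game of v^l, two
    payoffs moving by at most lambda |v^l - vstar| each. *)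
Lemma total_weighted_gap s x' y' :
  (1 <= k)%N -> simplex x' -> ball_tuple M s y' ->
  weight_sum R 1 T.+1 *
    (Fop M s (wavg 1 T.+1 (x ^~ s)) (kmean y') vstar
     - Fop M s x' (kmean (wavgY 1 T.+1 (y ^~ s))) vstar)
  <= 2 * Theta * k%:R ^+ 4
     + 2 * lam * \sum_(0 <= l < k) l.+1%:R ^+ 5 * delta l.
Proof.
move=> k1 sx' By'.
have T0 : (0 < T)%N.
  by rewrite epoch_startS // (leq_trans _ (leq_addl _ _)) // expn_gt0 k1.
rewrite kmean_wavg Fop_wavg_gap // sum_over_epochs big_add1 /=.
have By't : ball_mean M s (kmean y') by exists y'.
apply: (@le_trans _ _ (\sum_(0 <= l < k)
    (2 * Theta * k%:R ^+ 3 + 2 * lam * (l.+1%:R ^+ 5 * delta l)))); last first.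
  rewrite big_split /= sumr_const_nat subn0 -mulr_sumr lerD2r -[leLHS]mulr_natr.
  by rewrite -mulrA -exprSr.
apply: ler_sum_nat => l /andP[_ lk].
have l1k : (1 <= l.+1 <= k)%N by [].
have tT t : (lo l.+1 <= t < hi l.+1)%N -> (t <= T)%N.
  by move=> /andP[_]; rewrite ltnS => /leq_trans; apply; exact: epoch_start_mono.
apply: (@le_trans _ _ (\sum_(lo l.+1 <= t < hi l.+1) (t%:R *
   (Fop M s (x t s) (kmean y') (v l.+1) - Fop M s x' (kmean (y t s)) (v l.+1))
   + t%:R * (2 * (lam * delta l))))).
  apply: ler_sum_nat => t /tT /(iterates_feasible s)[sx By].
  rewrite -mulrDr ler_wpM2l //.
  have Bt : ball_mean M s (kmean (y t s)) by exists (y t s).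
  have := Fop_lipschitz M s (v l.+1) vstar sx (ball_mean_kernels By't).
  have := Fop_lipschitz M s (v l.+1) vstar sx' (ball_mean_kernels Bt).
  by rewrite !ler_norml -/(delta l) => /andP[? ?] /andP[? ?]; lra.
rewrite big_split /= -mulr_suml lerD //.
  apply: le_trans (epoch_weighted_gap l1k sx' By') _.
  rewrite mulrC ler_wpM2l ?mulr_ge0 ?Theta_step_ge0 //.
  rewrite -epoch_startS // -natrX ler_nat.
  by rewrite (leq_trans (epoch_start_le _)) // leq_exp2r.
apply: le_trans (ler_wpM2r _ (epoch_weight_le (ltn0Sn l))) _.
  by rewrite !mulr_ge0 ?norminf_ge0 ?(ltW (disc_gt0 M)).
by move: (l.+1%:R ^+ 5) => p; lra.
Qed.

End Run.

(** * The rate *)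

(** With p = T^(1/3) one has k^3 <= 3 p^3 <= (3/2)^3 p^3, hence k <= 3/2 p. *)
Lemma pow4_div_sqr_le (R : realType) (k T : nat) :
  (0 < T)%N -> (k ^ 3 <= 3 * T)%N ->
  k%:R ^+ 4 / T%:R ^+ 2 <= 9 * (T%:R `^ (2 / 3))^-1 :> R.
Proof.
move=> T0 kT; set p : R := T%:R `^ 3^-1.
have p0 : 0 < p by rewrite powR_gt0 // ltr0n.
have p3 : T%:R = p ^+ 3.
  by rewrite -powR_mulrn ?(ltW p0) // -powRrM mulVf // powRr1.
have -> : T%:R `^ (2 / 3) = p ^+ 2.
  by rewrite -powR_mulrn ?(ltW p0) // -powRrM mulrC.
have kp : k%:R <= 3 / 2 * p.
  rewrite -(@ler_pXn2r _ 3) ?nnegrE ?ler0n ?mulr_ge0 ?(ltW p0) //.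
  rewrite exprMn -p3 -natrX.
  have : (k ^ 3)%:R <= (3 * T)%:R :> R by rewrite ler_nat.
  have : 0 <= T%:R :> R by exact: ler0n.
  rewrite natrM; have -> : (3 / 2) ^+ 3 = 27 / 8 :> R by field.
  move: (k ^ 3)%:R T%:R => a b.
  lra.
rewrite p3 ler_pdivrMr ?exprn_gt0 //.
have -> : 9 * (p ^+ 2)^-1 * (p ^+ 3) ^+ 2 = 9 * p ^+ 4 by field; rewrite gt_eqF.
have : k%:R ^+ 4 <= (3 / 2 * p) ^+ 4.
  by rewrite lerXn2r ?nnegrE ?ler0n ?mulr_ge0 ?(ltW p0).
have := exprn_ge0 4 (ltW p0).
rewrite exprMn; lra.
Qed.

(** Only the first epoch is used, since v^1 is the vector on which the hidden
    constant may depend. *)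
Lemma Theta_step_ge (R : realType) (S A N : nat) (M : wdrmdp R S A N) (k : nat)
    (v : nat -> 'cV[R]_S) : (1 <= k)%N -> v 1%N != 0 ->
  disc M * norminf (v 1%N) * (Num.sqrt A%:R * Theta_X R A)
    <= Theta_step M k v
  /\ disc M * norminf (v 1%N) * ((N%:R * Num.sqrt A%:R)^-1 * Theta_Y M)
    <= Theta_step M k v.
Proof.
move=> k1 v0.
have := @epoch_Theta_le _ _ _ _ M k v 1%N k1.
have lam0 := ltW (disc_gt0 M).
have r0 : 0 <= Num.sqrt A%:R :> R by exact: sqrtr_ge0.
have x0 := Theta_X_ge0 R (actions_gt0 M).
have y0 := @Theta_Y_ge0 _ _ _ _ M.
have rN0 : 0 <= (N%:R * Num.sqrt A%:R)^-1 :> R.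
  by rewrite invr_ge0 mulr_ge0 ?ler0n.
have vle := norminf_le_norm2 (v 1%N).
have tx : disc M * norminf (v 1%N) * (Num.sqrt A%:R * Theta_X R A)
    <= Theta_X R A / step_x M (v 1%N).
  rewrite /step_x invrK.
  by have := ler_wpM2l (mulr_ge0 (mulr_ge0 lam0 r0) x0) vle; lra.
have ty : disc M * norminf (v 1%N) * ((N%:R * Num.sqrt A%:R)^-1 * Theta_Y M)
    <= Theta_Y M / step_y M (v 1%N).
  have -> : (step_y M (v 1%N))^-1
      = (N%:R * Num.sqrt A%:R)^-1 * (disc M * norm2 (v 1%N)).
    by rewrite invfM invrK.
  have := ler_wpM2l (mulr_ge0 (mulr_ge0 lam0 rN0) y0) vle.
  move: (_^-1) => z; lra.
have tx0 := le_trans (mulr_ge0 (mulr_ge0 lam0 (norminf_ge0 (v 1%N)))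
  (mulr_ge0 r0 x0)) tx.
have ty0 := le_trans (mulr_ge0 (mulr_ge0 lam0 (norminf_ge0 (v 1%N)))
  (mulr_ge0 rN0 y0)) ty.
by move=> h; split; lra.
Qed.

Lemma Theta_Y0_unique (R : realType) (S A N : nat) (M : wdrmdp R S A N) s
    (y y' : ktuple R S A N) :
  Theta_Y M = 0 -> ball_tuple M s y -> ball_tuple M s y' -> y = y'.
Proof.
move=> Y0 By By'; apply/funext => i; apply/eqP; rewrite -subr_eq0.
apply/negPn/negP => /norm2_gt0 yi.
have := D_Y_le_Theta By By'; rewrite Y0 leNgt => /negP; apply.
rewrite /D_Y (bigD1 i) //= ltr_pwDl ?mulr_gt0 ?exprn_gt0 //.
by apply: sumr_ge0 => j _; rewrite mulr_ge0 ?invr_ge0 ?sqr_ge0.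
Qed.

Lemma simplex1_unique (R : realType) (n : nat) (x x' : 'rV[R]_n) : (n <= 1)%N ->
  simplex x -> simplex x' -> x = x'.
Proof.
move=> n1 sx sx'; apply/rowP => j.
have all_j (z : 'rV[R]_n) : simplex z -> z 0 j = 1.
  move=> /simplex_sum <-; rewrite (bigD1 j) //= big1 ?addr0 // => i /negP[].
  by apply/eqP/val_inj; have := ltn_ord i; have := ltn_ord j; simpl; lia.
by rewrite !all_j.
Qed.

(** Stated with a hypothesis on the initial error because the reason for that
    hypothesis depends on the number of actions, while the rest does not. *)
Lemma duality_gap_rate (R : realType) (S A N : nat) (M : wdrmdp R S A N)
    (k : nat) (x : nat -> 'I_S -> 'rV[R]_A) (y : nat -> 'I_S -> ktuple R S A N)
    (v : nat -> 'cV[R]_S) (vstar : 'cV[R]_S) (D : R) :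
  FOM_run M k x y v -> is_value M vstar -> (1 <= k)%N ->
  norminf (v 1%N - vstar) <= D * (Theta_step M k v * k%:R ^+ 4) ->
  duality_gap M (fun s => wavg 1 (epoch_start k.+1).+1 (x ^~ s))
    (fun s => kmean (wavgY 1 (epoch_start k.+1).+1 (y ^~ s))) vstar
  <= 18 * (2 + 240 * disc M * (1 - disc M)^-1 ^+ 6 * (D + 24))
     * (Theta_step M k v * ((epoch_start k.+1)%:R `^ (2 / 3))^-1).
Proof.
move=> run vval k1 start; set T := epoch_start k.+1.
set Theta := Theta_step M k v in start *.
have Theta0 : 0 <= Theta by exact: Theta_step_ge0.
have lam0 := ltW (disc_gt0 M).
have T0 : (0 < T)%N.
  by rewrite /T epoch_startS // (leq_trans _ (leq_addl _ _)) // expn_gt0 k1.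
have TR : 0 < T%:R :> R by rewrite ltr0n.
set Q := 2 + _.
apply: duality_gap_le => s x' q' sx' [y' By' <-].
have := total_weighted_gap run vstar k1 sx' By'.
have := @sum_pow5_geometric_recursion R (disc M) (4 * Theta)
  (fun l => norminf (v l.+1 - vstar)) k lam0 (disc_lt1 M) _ _
  (value_error_rec run vval) k1.
move=> /(_ (mulr_ge0 (ler0n _ 4) Theta0) (fun=> norminf_ge0 _)).
rewrite -/T -/Theta.
set W := weight_sum R 1 T.+1.
have WE : 2 * W = T%:R * (0 + T.+1%:R) := weight_sumE R 0 T.
set G := Fop _ _ _ _ _ - Fop _ _ _ _ _.
set Sig := \sum_(0 <= l < k) _.
move=> SigB WG.
have a0 : 0 <= (1 - disc M)^-1 ^+ 6.
  by rewrite exprn_ge0 // invr_ge0 subr_ge0 (ltW (disc_lt1 M)).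
have Sig_le : Sig <= 120 * (1 - disc M)^-1 ^+ 6
    * ((D + 24) * (Theta * k%:R ^+ 4)).
  apply: le_trans SigB _; apply: (ler_wpM2l (mulr_ge0 (ler0n R 120) a0)).
  move: start => /=.
  move: (norminf (v 1%N - vstar)) (k%:R ^+ 4) (Theta) => d k4 th h.
  lra.
have {}WG : W * G <= Q * (Theta * k%:R ^+ 4).
  apply: le_trans WG _.
  have := ler_wpM2l (mulr_ge0 (ler0n _ 2) lam0) Sig_le.
  rewrite /Q; move: (k%:R ^+ 4) (_ ^+ 6) => k4 a h; lra.
have Q_Theta0 : 0 <= Q * Theta -> G <= 2 * (Q * Theta) * (k%:R ^+ 4 / T%:R ^+ 2).
  move=> QT; have [G0|G0] := leP G 0.
    apply: le_trans G0 (mulr_ge0 (mulr_ge0 (ler0n _ 2) QT) _).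
    by apply: divr_ge0; apply: exprn_ge0; exact: ler0n.
  rewrite [leRHS]mulrA ler_pdivlMr ?exprn_gt0 //.
  apply: (@le_trans _ _ (2 * W * G)).
    rewrite mulrC ler_wpM2r ?(ltW G0) // WE add0r expr2 ler_wpM2l ?(ltW TR) //.
    by rewrite ler_nat.
  by move: WG; lra.
have D0 : 0 <= D * (Theta * k%:R ^+ 4) by exact: le_trans (norminf_ge0 _) start.
have kR : 0 < k%:R ^+ 4 :> R by rewrite exprn_gt0 // ltr0n.
have QT : 0 <= Q * Theta.
  have DT : 0 <= D * Theta by rewrite -(pmulr_lge0 _ kR) -mulrA.
  have D24 : 0 <= (D + 24) * Theta by rewrite mulrDl addr_ge0 // mulr_ge0.
  rewrite /Q mulrDl -[_ * _ * Theta]mulrA; apply: addr_ge0; first exact: mulr_ge0.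
  exact: mulr_ge0 (mulr_ge0 (mulr_ge0 (ler0n _ 240) lam0) a0) D24.
apply: le_trans (Q_Theta0 QT) _.
have := ler_wpM2l QT (pow4_div_sqr_le R T0 (epoch_start_ge k)).
rewrite -/T; move: (k%:R ^+ 4 / _) ((_ `^ _)^-1) => p q; lra.
Qed.

Theorem theorem1 (R : realType) :
  exists C : R -> R -> R -> R,
  forall (S A N : nat) (M : wdrmdp R S A N),
  exists k0 : nat, ((1 < A)%N -> k0 = 1%N) /\
  forall (vstar : 'cV[R]_S) (k : nat)
    (x : nat -> 'I_S -> 'rV[R]_A) (y : nat -> 'I_S -> ktuple R S A N)
    (v : nat -> 'cV[R]_S),
  is_value M vstar ->
  (1 <= k)%N -> (k0 <= k)%N ->
  FOM_run M k x y v ->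
  let T := (\sum_(1 <= l < k.+1) l ^ 2)%N in
  let xbar := fun s => wavg 1 T.+1 (fun t => x t s) in
  let ybar := fun s => kmean (wavgY 1 T.+1 (fun t => y t s)) in
  duality_gap M xbar ybar vstar
    <= C (disc M) (norminf (cost M)) (norminf (v 1%N))
       * (Num.sqrt S%:R / Num.sqrt N%:R * R_X R A * R_Y M
          * Theta_step M k v * (T%:R `^ (2 / 3))^-1).
Proof.
pose D (lam c n : R) : R := (n + c / (1 - lam)) / (lam * n).
exists (fun lam c n =>
  18 * (2 + 240 * lam * (1 - lam)^-1 ^+ 6 * (D lam c n + 24))) => S A N M.
exists (if (1 < A)%N then 1%N else (Num.truncn (N%:R / Theta_Y M)).+1).
split=> [->//|vstar k x y v vval k1 k0 run]; cbv zeta.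
set T := (\sum_(1 <= l < k.+1) l ^ 2)%N; set xbar := fun s => _.
set ybar := fun s => _.
have lam0 := disc_gt0 M; have lam1 := disc_lt1 M.
have v0 : v 1%N != 0 by exact: (run_v_neq0 run).
have n0 := norminf_gt0 v0.
set DD := D _ _ _; set Theta := Theta_step M k v.
have lam1' : 0 < 1 - disc M by rewrite subr_gt0.
have c0 : 0 <= norminf (cost M) / (1 - disc M).
  by rewrite divr_ge0 ?norminf_ge0 // ltW.
have D0 : 0 <= DD.
  by rewrite divr_ge0 ?mulr_ge0 ?addr_ge0 ?(ltW n0) ?(ltW lam0).
set C := 18 * _.
have C0 : 0 <= C.
  have a0 : 0 <= (1 - disc M)^-1 ^+ 6 by rewrite exprn_ge0 ?invr_ge0 // ltW.
  apply: mulr_ge0 (ler0n _ 18) (addr_ge0 (ler0n _ 2) _).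
  apply: mulr_ge0 (addr_ge0 D0 (ler0n _ 24)).
  exact: mulr_ge0 (mulr_ge0 (ler0n _ 240) (ltW lam0)) a0.
have Theta0 : 0 <= Theta by exact: Theta_step_ge0.
have Tp0 : 0 <= (T%:R `^ (2 / 3))^-1 :> R by rewrite invr_ge0 powR_ge0.
have scale_ge1 : 1 <= Num.sqrt S%:R / Num.sqrt N%:R * R_X R A * R_Y M.
  by rewrite mulrAC mulr_ege1 ?scaled_R_Y_ge1 // (R_X_ge1 R (actions_gt0 M)).
suff gap_le : duality_gap M xbar ybar vstar
    <= C * (Theta * (T%:R `^ (2 / 3))^-1).
  apply: le_trans gap_le _; rewrite ler_wpM2l // -[leRHS]mulrA.
  by rewrite ler_peMl // mulr_ge0.
(* With one action and Theta_Y = 0 both strategy sets of each state are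
   singletons. *)
have [noise0 | noise] := boolP (~~ (1 < A)%N && (Theta_Y M == 0)).
  apply: le_trans (_ : 0 <= _); last exact: mulr_ge0 C0 (mulr_ge0 Theta0 Tp0).
  case/andP: noise0 => A1 /eqP Y0; rewrite -leqNgt in A1.
  have T0 : (1 < T.+1)%N.
    rewrite ltnS /T -/(epoch_start k.+1) epoch_startS //.
    by rewrite (leq_trans _ (leq_addl _ _)) // expn_gt0 k1.
  apply: duality_gap_le => s x' q' sx' [y' By' <-].
  have feas t : (1 <= t < T.+1)%N -> simplex (x t s) /\ ball_tuple M s (y t s).
    by move=> /andP[_ tT]; exact: (iterates_feasible run).
  have -> : xbar s = x'.
    apply: simplex1_unique A1 _ sx'; apply: wavg_convex => //.
      exact: simplex_convex.
    by move=> t /feas[].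
  have -> : y' = wavgY 1 T.+1 (y ^~ s).
    apply: Theta_Y0_unique Y0 By' _; rewrite wavgYE.
    apply: (@wavg_convex R ('I_N -> 'M[R]_(A, S)) (ball_tuple M s)) => //.
      exact: ball_tuple_convex.
    by move=> t /feas[].
  by rewrite subrr.
apply: (duality_gap_rate run vval k1).
have k4 : 1 <= k%:R ^+ 4 :> R by rewrite exprn_ege1 // ler1n.
(* Theta k^4 dominates lambda |v^1|: through Theta_X when A > 1, and through
   k >= N / Theta_Y when A = 1. *)
have large : disc M * norminf (v 1%N) <= Theta * k%:R ^+ 4.
  have ln0 := mulr_ge0 (ltW lam0) (ltW n0).
  have [hX hY] := Theta_step_ge M k1 v0.
  have [A1|A1] := boolP (1 < A)%N.
    apply: (@le_trans _ _ Theta); last by rewrite ler_peMr.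
    have sqrtA : 1 <= Num.sqrt A%:R :> R.
      by rewrite -[leLHS]sqrtr1 ler_wsqrtr // ler1n ltnW.
    by apply: le_trans hX; rewrite ler_peMr // mulr_ege1 ?(Theta_X_ge1 R A1).
  rewrite A1 /= in noise; rewrite (negbTE A1) in k0.
  have sqrtA : Num.sqrt A%:R = 1 :> R.
    have -> : A = 1%N by apply/eqP; rewrite eqn_leq (actions_gt0 M) leqNgt A1.
    exact: sqrtr1.
  have Y0 : 0 < Theta_Y M by rewrite lt_neqAle eq_sym noise Theta_Y_ge0.
  have NR : 0 < N%:R :> R by rewrite ltr0n (samples_gt0 M).
  have NY : N%:R / Theta_Y M <= k%:R ^+ 4.
    apply: le_trans (_ : k%:R <= _); last first.
      by rewrite -[leLHS]expr1 ler_weXn2l ?ler1n.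
    by apply: le_trans (ltW (truncnS_gt _)) _; rewrite ler_nat.
  apply: le_trans (ler_wpM2r (le_trans ler01 k4) hY).
  rewrite -[leRHS]mulrA ler_peMr //.
  rewrite sqrtA mulr1; move: NY; rewrite ler_pdivrMr // => NY.
  by rewrite -mulrA ler_pdivlMl // mulr1 mulrC.
apply: (@le_trans _ _ (norminf (v 1%N) + norminf (cost M) / (1 - disc M))).
  have vs : norminf vstar <= norminf (cost M) / (1 - disc M).
    by rewrite ler_pdivlMr // mulrC; exact: norminf_value_le.
  apply: norminf_le => [|i j]; first by rewrite addr_ge0 ?norminf_ge0.
  rewrite mxE [(- vstar) _ _]mxE (le_trans (ler_normB _ _)) //.
  rewrite lerD ?le_norminf //.
  exact: le_trans (le_norminf _ _ _) vs.
have -> : norminf (v 1%N) + norminf (cost M) / (1 - disc M)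
    = DD * (disc M * norminf (v 1%N)).
  by rewrite /DD /D divfK // mulf_neq0 // gt_eqF.
by rewrite ler_wpM2l.
Qed.
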